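(* Let $d\ge 2$, $\varepsilon\in(0,1)$, $s=1+\varepsilon$, and let $x,z\in\mathcal X$. Then: (1) The following deterministic inequality holds: $$\varepsilon-\delta_2(d,\varepsilon)\;\le\;K_s(x,z)-\bigl(1-d_G(x,z)\bigr)\;\le\;\varepsilon+\delta_1(d,\varepsilon),$$ where $$\delta_1(d,\varepsilon)=\frac{e^{-d\varepsilon^2/16}}{\sqrt d}-\frac12\,\frac{e^{-\varepsilon d/2}(1+\varepsilon)^{d/2}}{\sqrt d},\qquad \delta_2(d,\varepsilon)=\frac{e^{-d\varepsilon^2/16}}{\sqrt d}+(1+\varepsilon)e^{-d\varepsilon^2/8}.$$ (2) For every fixed $\varepsilon\in(0,1)$, $\delta_1(d,\varepsilon)\to0$ and $\delta_2(d,\varepsilon)\to0$ as $d\to\infty$, so that $K_s(x,z)-\bigl(s-d_G(x,z)\bigr)\to 0$ as $d\to\infty$. (3) $K_s$ is symmetric and positive semi-definite on $\mathcal X$, and it is $G$-invariant: $K_s(gx,g'z)=K_s(x,z)$ for all $g,g'\in G$, $x,z\in\mathcal X$.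
   Context: Let $\mathcal X\subset\mathbb S^{d-1}$ (unit sphere of $\mathbb R^d$). Let $G$ be a compact group acting on $\mathbb R^d$ by orthogonal (unitary) linear maps, with normalized Haar measure $\mu$. Fix $\varepsilon\in(0,1)$ and set $s=1+\varepsilon$. A random template $t$ is drawn as follows: draw $\nu\sim\mathcal N(0,\tfrac1d I_d)$; set $t=\nu$ if $\|\nu\|_2^2<1+\varepsilon$, and $t=\perp$ (a null template) otherwise. For $x\in\mathbb R^d$, a template $t\ne\perp$ and $\tau\in\mathbb R$, define $\psi(x,t,\tau)=\mu(\{g\in G:\langle x,gt\rangle\le\tau\})$ (the CDF of $\langle x,gt\rangle$ with $g\sim\mu$), and by convention $\psi(x,\perp,\tau)=0$. Define the kernel $$K_s(x,z)=\mathbb E_t\int_{-s}^{s}\psi(x,t,\tau)\,\psi(z,t,\tau)\,d\tau,$$ and the orbit distance $$d_G(x,z)=\frac{1}{\sqrt{2\pi d}}\int_G\int_G\|gx-g'z\|_2\,d\mu(g)\,d\mu(g').$$ *)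

(* Defs.v *)
From HB Require Import structures.
From mathcomp Require Import all_boot all_order all_algebra.
From mathcomp Require Import all_classical all_reals all_analysis.
Set Implicit Arguments. Unset Strict Implicit. Unset Printing Implicit Defensive.
Import Order.TTheory GRing.Theory Num.Theory.
Local Open Scope classical_set_scope.
Local Open Scope ring_scope.

Section Defs.
Context {R : realType}.

Definition dotv (d : nat) (x y : 'cV[R]_d) : R := \sum_(i < d) x i 0 * y i 0.
Definition normv (d : nat) (x : 'cV[R]_d) : R := Num.sqrt (dotv x x).
Definition on_sphere (d : nat) (x : 'cV[R]_d) : Prop := dotv x x = 1.

Definition orth_haar_action (d : nat) (dG : measure_display)
  (G : measurableType dG) (mu : probability G R)
  (mulg : G -> G -> G) (invg : G -> G) (oneg : G) (rho : G -> 'M[R]_d) : Prop :=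
      (forall a b c, mulg a (mulg b c) = mulg (mulg a b) c) /\
      (forall a, mulg oneg a = a /\ mulg a oneg = a) /\
      (forall a, mulg (invg a) a = oneg /\ mulg a (invg a) = oneg) /\
      (rho oneg = 1%:M /\ forall a b, rho (mulg a b) = rho a *m rho b) /\
      (forall a, (rho a)^T *m rho a = 1%:M) /\
      (forall i j, measurable_fun setT (fun g => rho g i j)) /\
      (forall a, measurable_fun setT (mulg a) /\
                 measurable_fun setT (fun g => mulg g a)) /\
      (forall a (A : set G), measurable A ->
         mu ((mulg a) @^-1` A) = mu A /\ mu ((fun g => mulg g a) @^-1` A) = mu A).

Definition psi (d : nat) (dG : measure_display) (G : measurableType dG)
  (mu : probability G R) (rho : G -> 'M[R]_d) (x t : 'cV[R]_d) (tau : R) : R :=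
  fine (mu [set g | dotv x (rho g *m t) <= tau]).

(** n-fold integral against the product of n independent N(0, sigma^2)
    laws (sigma is the standard deviation). *)
Fixpoint iter_gauss (sigma : R) (n : nat) (f : seq R -> \bar R) : \bar R :=
  match n with
  | 0 => f [::]
  | n'.+1 => (\int[normal_prob 0 sigma]_x iter_gauss sigma n' (fun l => f (x :: l)))%E
  end.

Definition gauss_expect (d : nat) (f : 'cV[R]_d -> \bar R) : \bar R :=
  iter_gauss (Num.sqrt (d%:R^-1)) d (fun l => f (\col_(i < d) nth 0 l i)).

(** K_s(x,z) with s = 1 + eps; the null template (||nu||^2 >= 1+eps)
    contributes psi = 0. *)
Definition Ks (d : nat) (dG : measure_display) (G : measurableType dG)
  (mu : probability G R) (rho : G -> 'M[R]_d) (eps : R) (x z : 'cV[R]_d) : R :=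
  let s := 1 + eps in
  fine (gauss_expect (fun nu : 'cV[R]_d =>
    if dotv nu nu < s then
      (\int[lebesgue_measure]_(tau in `[(- s)%R, s%R]) (psi mu rho x nu tau * psi mu rho z nu tau)%:E)%E
    else 0%E)).

Definition dG_orbit (d : nat) (dG : measure_display) (G : measurableType dG)
  (mu : probability G R) (rho : G -> 'M[R]_d) (x z : 'cV[R]_d) : R :=
  fine (\int[mu]_g \int[mu]_g' (normv (rho g *m x - rho g' *m z))%:E)%E
  / Num.sqrt (pi *+ 2 * d%:R).

Definition delta1 (d : nat) (eps : R) : R :=
  expR (- (d%:R * eps ^+ 2) / 16) / Num.sqrt d%:R
  - 2^-1 * (expR (- (eps * d%:R) / 2) * ((1 + eps) `^ (d%:R / 2)))
    / Num.sqrt d%:R.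

Definition delta2 (d : nat) (eps : R) : R :=
  expR (- (d%:R * eps ^+ 2) / 16) / Num.sqrt d%:R
  + (1 + eps) * expR (- (d%:R * eps ^+ 2) / 8).

End Defs.

(* Main.v *)
Require Import Defs.
From HB Require Import structures.
From mathcomp Require Import all_boot all_order all_algebra.
From mathcomp Require Import all_classical all_reals all_analysis.
From mathcomp Require Import ring lra measurable_realfun.
Import Order.TTheory GRing.Theory Num.Theory.
Local Open Scope classical_set_scope.
Local Open Scope ring_scope.

(** With [s = 1 + eps] and [Max] the larger of [<x, g nu>] and [<z, g' nu>] for
    independent Haar [g], [g'], integrating [psi x * psi z] over [tau] in [[-s, s]]
    gives [s - E Max], because [|Max| <= s] on the event [|nu|^2 < s]. Averaging over
    [nu] and [- nu] replaces [Max] by half of [|<w, nu>|], [w = g^-1 x - g'^-1 z], and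
    [E |<w, nu>| = |w| sqrt (2 / (pi d))], so that
      [K_s = s - d_G - s P (|nu|^2 >= s) + E (|<w, nu>| / 2; |nu|^2 >= s)].
    The last term is at most [sqrt (P (|nu|^2 >= s) / d)] by Cauchy-Schwarz. The tail
    is bounded above by Chernoff's inequality. For the lower bound, homogeneity of
    Lebesgue measure gives [E (e^(|X|^2/2); |X| <= r) = k r^d] for a standard Gaussian
    [X], and the layer-cake formula for [e^(-r^2/2)] expresses both [1] and the tail
    through [k]; this leaves the Stirling-type estimate
    [int_0^oo r^(d+1) e^(-r^2/2) dr <= 2 d^((d+1)/2) e^(-d/2)], proved by induction
    from [d] to [d + 2]. *)

(** * One-dimensional Gaussian integrals *)

Section OneDim.
Import numFieldNormedType.Exports.
Context {R : realType}.
Local Notation leb := (@lebesgue_measure R).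
Local Open Scope ereal_scope.

(** The weight [e^(|X|^2/2)] cancels the Gaussian density, so a weighted Gaussian integral is a
    Lebesgue integral up to a constant. This replaces Lebesgue measure on [R^d], polar coordinates
    and the Gamma function: homogeneity is proved one coordinate at a time, and the ball constant
    [k] is known only through the fact that [k] times a radial moment equals 1. The Stirling-type
    estimate is the resulting lower bound on [k]. Both tail bounds matter because
    [s P (|nu|^2 >= s)] enters with a minus sign: its upper bound gives the lower estimate with
    [delta2], its lower bound gives the negative term of [delta1]. The number [e^(-d eps^2/16)] is
    the square root of the Chernoff bound [e^(-d eps^2/8)]. Integrands are kept nonnegative in
    [\bar R], so Tonelli applies without integrability, and identities with a difference are stated
    as sums. Only positive semi-definiteness needs signed integrals. *)

Lemma measurable_affine (a b : R) :
  measurable_fun setT (fun x : measurableTypeR R => a * x + b : measurableTypeR R)%R.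
Proof. by apply: measurable_funD => //; exact: measurable_funM. Qed.

(** Closed with [Defined]: its values are unfolded when it is compared with Lebesgue measure on
    intervals. *)
Definition affine_measure (a b : R) : {measure set (measurableTypeR R) -> \bar R}.
Proof.
pose m : {measure set (measurableTypeR R) -> \bar R} :=
  (mscale (NngNum (normr_ge0 a))
  (pushforward (lebesgue_measure : {measure set (measurableTypeR R) -> \bar R})
    (fun x : measurableTypeR R => a * x + b : measurableTypeR R)%R)).
exact: (m (measurable_affine a b)).
Defined.

(** Uniqueness of Lebesgue measure reduces the claim to half-open intervals. For [a < 0] the
    preimage of []c, d]] is closed on the left instead, which leaves its length unchanged. *)
Lemma lebesgue_measure_affine (a b : R) (A : set R) : (a != 0)%R -> measurable A ->
  leb A = `|a|%:E * leb ((fun x => a * x + b)%R @^-1` A).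
Proof.
move=> a0 mA.
pose m := affine_measure a b.
apply: (@lebesgue_measure_unique R m) => //.
move=> X [[c d]] _ <- /=.
rewrite /m/affine_measure/= /mscale/= /pushforward.
move: a0; rewrite neq_lt => /orP[a0|a0].
- rewrite (_ : _ @^-1` _ = `[(d - b) / a, (c - b) / a[%classic)%R; last first.
    apply/seteqP; split => x /=; rewrite !in_itv/= ler_ndivrMr// ltr_ndivlMr// lerBrDr ltrBlDr [(x*a)%R]mulrC andbC//.
  rewrite !lebesgue_measure_itv/= !lte_fin ltr0_norm// ltr_nM2r ?invr_lt0// ltrD2r.
  case: ifPn => [cd|]; last by rewrite mule0.
  by rewrite -!EFinD -EFinM; congr EFin; field; rewrite lt_eqF.
- rewrite (_ : _ @^-1` _ = `](c - b) / a, (d - b) / a]%classic)%R; last first.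
    by apply/seteqP; split => x /=; rewrite !in_itv/= ler_pdivlMr// ltr_pdivrMr// lerBrDr ltrBlDr [(x*a)%R]mulrC.
  rewrite !lebesgue_measure_itv/= !lte_fin gtr0_norm// ltr_pM2r ?invr_gt0// ltrD2r.
  case: ifPn => [cd|]; last by rewrite mule0.
  by rewrite -!EFinD -EFinM; congr EFin; field; rewrite gt_eqF.
Qed.

Lemma ge0_integral_affine (a b : R) (f : R -> \bar R) : (a != 0)%R ->
  measurable_fun setT f -> (forall x, 0 <= f x) ->
  \int[leb]_x f x = `|a|%:E * \int[leb]_x f (a * x + b)%R.
Proof.
move=> a0 mf f0.
pose m := affine_measure a b.
transitivity (\int[m]_x f x).
  by apply: eq_measure_integral => A mA _; exact: lebesgue_measure_affine.
rewrite ge0_integral_mscale// ge0_integral_pushforward//.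
exact: measurable_affine.
Qed.

(** The Radon-Nikodym derivative is only an abstract function; it equals [normal_pdf] almost
    everywhere because both have the same integral over every measurable set. *)
Lemma ge0_integral_normal_prob (m s : R) (f : R -> \bar R) :
  measurable_fun setT f -> (forall x, 0 <= f x) ->
  \int[normal_prob m s]_x f x = \int[leb]_x (f x * (normal_pdf m s x)%:E).
Proof.
move=> mf f0.
have dom := normal_prob_dominates m s.
rewrite -(Radon_Nikodym_SigmaFinite.change_of_variables dom)//=.
have mpdf : measurable_fun setT (fun x => (normal_pdf m s x)%:E).
  by apply/measurable_EFinP; exact: measurable_normal_pdf.
apply: ae_eq_integral => //.
- apply: emeasurable_funM => //; apply: (measurable_int leb).
  exact: Radon_Nikodym_SigmaFinite.f_integrable.
- exact: emeasurable_funM.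
- apply: ae_eqe_mul2l => /=.
  apply: integral_ae_eq => //=.
  + exact: Radon_Nikodym_SigmaFinite.f_integrable.
  + by move=> E E01 mE; rewrite -Radon_Nikodym_SigmaFinite.f_integral//=.
Qed.

Local Notation N01 := (normal_prob 0%R (1%R : R)).

Lemma normal_pdf01 (x : R) : (normal_pdf 0 1 x = (Num.sqrt (pi *+ 2))^-1 * expR (- x ^+ 2 / 2))%R.
Proof.
rewrite normal_pdfE ?oner_neq0// /normal_peak /normal_fun expr1n mul1r subr0.
by rewrite mulr2n.
Qed.

Lemma ge0_integral_normal_scale (s : R) (f : R -> \bar R) : (0 < s)%R ->
  measurable_fun setT f -> (forall x, 0 <= f x) ->
  \int[normal_prob 0%R s]_x f x = \int[N01]_x f (s * x)%R.
Proof.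
move=> s0 mf f0.
have ms : measurable_fun setT (fun x : R => s * x)%R by exact: measurable_funM.
rewrite (ge0_integral_normal_prob 0 s _ mf f0).
rewrite (ge0_integral_normal_prob 0 1 _ (measurableT_comp mf ms) (fun x => f0 (s * x)%R)).
have mp : measurable_fun setT (fun x => f x * (normal_pdf 0 s x)%:E).
  by apply: emeasurable_funM => //; apply/measurable_EFinP; exact: measurable_normal_pdf.
have p0 x : 0 <= f x * (normal_pdf 0 s x)%:E.
  by rewrite mule_ge0// lee_fin normal_pdf_ge0.
rewrite (ge0_integral_affine s 0%R _ _ mp p0) ?gt_eqF//.
rewrite -ge0_integralZl//; first last.
  exact: (measurableT_comp mp (measurable_affine s 0)).
apply: eq_integral => x _; rewrite addr0 muleCA; congr (_ * _).
rewrite -EFinM normal_pdf01 normal_pdfE ?gt_eqF// /normal_peak /normal_fun gtr0_norm//.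
congr EFin; rewrite -mulrnAr sqrtrM ?sqr_ge0// sqrtr_sqr gtr0_norm// invfM !mulrA mulfV ?gt_eqF// mul1r.
by congr (_ * expR _)%R; field; rewrite gt_eqF.
Qed.

(** Against [e^(x^2/2)] the standard Gaussian is Lebesgue measure divided by [sqrt (2 pi)], so this
    is the homogeneity of Lebesgue measure. *)
Lemma ge0_integral_normal_tilt (c : R) (h : R -> \bar R) : (c != 0)%R ->
  measurable_fun setT h -> (forall x, 0 <= h x) ->
  \int[N01]_x (h (c * x)%R * (expR (x ^+ 2 / 2))%:E) =
  (`|c|^-1)%:E * \int[N01]_x (h x * (expR (x ^+ 2 / 2))%:E).
Proof.
move=> c0 mh h0.
have mc : measurable_fun setT (fun x : R => c * x)%R by exact: measurable_funM.
have me : measurable_fun setT (fun x : R => (expR (x ^+ 2 / 2))%:E).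
  apply/measurable_EFinP; apply: measurableT_comp => //; apply: measurable_funM => //.
have E (g : R -> \bar R) : measurable_fun setT g -> (forall x, 0 <= g x) ->
   \int[N01]_x (g x * (expR (x ^+ 2 / 2))%:E) = ((Num.sqrt (pi *+ 2))^-1)%:E * \int[leb]_x g x.
  move=> mg g0; rewrite ge0_integral_normal_prob//; last 2 first.
    exact: emeasurable_funM.
    by move=> x; rewrite mule_ge0// lee_fin expR_ge0.
  rewrite -ge0_integralZl// ?lee_fin ?invr_ge0//.
  apply: eq_integral => x _; rewrite -muleA -EFinM muleC normal_pdf01 mulrCA mulNr -expRD addrN expR0 mulr1.
  by [].
rewrite (E (fun x => h (c * x)%R))//; last exact: measurableT_comp.
rewrite E// muleCA; congr (_ * _).
rewrite (ge0_integral_affine c 0%R _ c0 mh h0) muleA -EFinM mulVf ?normr_eq0// mul1e.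
by apply: eq_integral => x _; rewrite addr0.
Qed.

(** The tilt identity at [c = -1], applied to [f x e^(-x^2/2)] so that the weight disappears. *)
Lemma ge0_integral_normal_opp (f : R -> \bar R) :
  measurable_fun setT f -> (forall x, 0 <= f x) ->
  \int[N01]_x f (- x)%R = \int[N01]_x f x.
Proof.
move=> mf f0.
have me (c : R) : measurable_fun setT (fun x : R => (expR (c * x ^+ 2 / 2))%:E).
  apply/measurable_EFinP; apply: measurableT_comp => //; apply: measurable_funM => //.
  exact: measurable_funM.
pose h x := f x * (expR (-1 * x ^+ 2 / 2))%:E.
have mh : measurable_fun setT h by exact: emeasurable_funM.
have h0 x : 0 <= h x by rewrite mule_ge0// lee_fin expR_ge0.
have N10 : (-1 != 0 :> R)%R by rewrite oppr_eq0 oner_eq0.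
have := ge0_integral_normal_tilt (-1)%R h N10 mh h0.
rewrite normrN1 invr1 mul1e => H.
have E g x : h g * (expR (x ^+ 2 / 2))%:E = f g * (expR (-1 * g ^+ 2 / 2 + x ^+ 2 / 2))%:E.
  by rewrite /h -muleA -EFinM -expRD.
have E2 (x : R) : (-1 * x ^+ 2 / 2 + x ^+ 2 / 2 = 0)%R by ring.
transitivity (\int[N01]_x (h (-1 * x)%R * (expR (x ^+ 2 / 2))%:E)).
  by apply: eq_integral => x _; rewrite E mulN1r sqrrN E2 expR0 mule1.
rewrite H; by apply: eq_integral => x _; rewrite E E2 expR0 mule1.
Qed.

(** For independent standard [x], [y] and [u = (a x + b y) / r], the left side is the joint density
    of [(x, u)], with Jacobian [|r / b|]; the right side is the density of [u] times the conditional
    density of [x] given [u]. *)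
Lemma normal_pdf01_convolution (a b u x : R) : (b != 0)%R ->
  let r := Num.sqrt (a ^+ 2 + b ^+ 2) in
  (`|r / b| * (normal_pdf 0 1 x * normal_pdf 0 1 (r / b * u - a * x / b)) =
   normal_pdf 0 1 u * normal_pdf (a * u / r) (`|b| / r) x)%R.
Proof.
move=> b0 r.
have r2 : (r ^+ 2 = a ^+ 2 + b ^+ 2)%R by rewrite sqr_sqrtr// addr_ge0// sqr_ge0.
have r0 : (0 < r)%R by rewrite sqrtr_gt0 ltr_wpDl ?sqr_ge0// exprn_even_gt0.
have rn : (r != 0)%R by rewrite gt_eqF.
have bn : (`|b| != 0)%R by rewrite normr_eq0.
rewrite !normal_pdf01 normal_pdfE ?mulf_neq0 ?invr_eq0// /normal_peak /normal_fun.
rewrite -mulrnAr sqrtrM ?sqr_ge0// sqrtr_sqr [`|_ / r|%R]normrM [`|r / _|%R]normrM !normfV normr_id (gtr0_norm r0).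
set k := ((Num.sqrt _)^-1)%R.
rewrite invfM invf_div -/k.
transitivity (r / `|b| * k * k * expR (- x ^+ 2 / 2 + - (r / b * u - a * x / b) ^+ 2 / 2))%R.
  by rewrite expRD; ring.
transitivity (r / `|b| * k * k * expR (- u ^+ 2 / 2 + - (x - a * u / r) ^+ 2 / ((`|b| / r) ^+ 2 *+ 2)))%R; last first.
  by rewrite expRD; ring.
congr (_ * expR _)%R.
rewrite expr_div_n real_normK ?num_real//.
have -> : (- (x - a * u / r) ^+ 2 / (b ^+ 2 / r ^+ 2 *+ 2) = - (r * x - a * u) ^+ 2 / (2 * b ^+ 2))%R.
  by field; rewrite b0 rn.
have -> : (r / b * u - a * x / b = (r * u - a * x) / b)%R by field.
rewrite expr_div_n.
(* The added term vanishes as [r^2 = a^2 + b^2]; with it the identity holds for free variables and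
   [field] closes it. *)
transitivity (- u ^+ 2 / 2 + - (r * x - a * u) ^+ 2 / (2 * b ^+ 2)
  + (r ^+ 2 - (a ^+ 2 + b ^+ 2)) * (x ^+ 2 - u ^+ 2) / (2 * b ^+ 2))%R; first by field.
by rewrite r2 subrr !mul0r addr0.
Qed.

(** Change the inner variable from [y] to [u], exchange the integrals, and integrate out [x], whose
    conditional density has mass 1. This stands in for rotation invariance in the plane. *)
Lemma ge0_integral_normal_add (a b : R) (f : R -> \bar R) :
  measurable_fun setT f -> (forall x, 0 <= f x) ->
  \int[N01]_x \int[N01]_y f (a * x + b * y)%R =
  \int[N01]_x f (Num.sqrt (a ^+ 2 + b ^+ 2) * x)%R.
Proof.
move=> mf f0.
have mp m s : measurable_fun setT (fun x : R => (normal_pdf m s x)%:E).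
  by apply/measurable_EFinP; exact: measurable_normal_pdf.
have p0 m s (x : R) : 0 <= (normal_pdf m s x)%:E by rewrite lee_fin normal_pdf_ge0.
(* Degenerate case: [u] no longer determines [y]. The sum is [a x], and evenness turns [a] into
   [|a|]. *)
have [->|b0] := eqVneq b 0%R.
  rewrite expr0n addr0 sqrtr_sqr.
  transitivity (\int[N01]_x f (a * x)%R).
    apply: eq_integral => x _.
    under eq_integral do rewrite mul0r addr0.
    rewrite integral_cst//= [X in _ * X](_ : _ = 1) ?mule1//; exact: probability_setT.
  have [a0|a0] := leP 0%R a; first by rewrite ger0_norm.
  rewrite -(ge0_integral_normal_opp (fun x => f (a * x)%R))//; last first.
    by apply: (measurableT_comp mf); exact: measurable_funM.
  by apply: eq_integral => x _; rewrite ltr0_norm// mulrN mulNr.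
set r := Num.sqrt _.
have r0 : (0 < r)%R by rewrite sqrtr_gt0 ltr_wpDl ?sqr_ge0// exprn_even_gt0.
have rb0 : (r / b != 0)%R by rewrite mulf_neq0 ?invr_eq0// gt_eqF.
have inner x : \int[N01]_y f (a * x + b * y)%R =
    \int[leb]_u (`|r / b|%:E * (f (r * u)%R * (normal_pdf 0 1 (r / b * u - a * x / b))%:E)).
  have mg : measurable_fun setT (fun y => f (a * x + b * y)%R).
    by apply: (measurableT_comp mf); apply: measurable_funD => //; exact: measurable_funM.
  rewrite (ge0_integral_normal_prob 0 1 _ mg (fun y => f0 _)).
  rewrite (ge0_integral_affine (r / b) (- (a * x / b))%R _ rb0 (emeasurable_funM mg (mp 0%R 1%R))); last first.
    by move=> y; rewrite mule_ge0.
  rewrite -ge0_integralZl//; first last.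
  - by move=> y _; rewrite mule_ge0.
  - by apply: (measurableT_comp (emeasurable_funM mg (mp 0%R 1%R))); exact: measurable_affine.
  apply: eq_integral => u _; congr (_ * (f _ * _)).
  by field.
under eq_integral do rewrite inner.
have maff : measurable_fun setT (fun p : R * R => r / b * p.2 - a * p.1 / b)%R.
  apply: measurable_funB; apply: measurable_funM => //; exact: measurable_funM.
have mr : measurable_fun setT (fun u : R => r * u)%R by exact: measurable_funM.
pose G (p : R * R) := `|r / b|%:E * (f (r * p.2)%R * (normal_pdf 0 1 (r / b * p.2 - a * p.1 / b))%:E).
have mG : measurable_fun setT G.
  apply: emeasurable_funM => //; apply: emeasurable_funM.
    by apply: (measurableT_comp mf); exact: measurable_funM.
  by apply: (measurableT_comp (mp 0%R 1%R)).
have G0 p : 0 <= G p by rewrite mule_ge0// mule_ge0.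
have mFG : measurable_fun setT (fun x => \int[leb]_u G (x, u)).
  exact: (measurable_fun_fubini_tonelli_F (m2 := leb) G).
rewrite (ge0_integral_normal_prob 0 1 (fun x => \int[leb]_u G (x, u)) mFG); last first.
  by move=> x; apply: integral_ge0.
pose H (p : R * R) := (normal_pdf 0 1 p.1)%:E * G p.
have mH : measurable_fun setT H.
  by apply: emeasurable_funM => //; apply: (measurableT_comp (mp 0%R 1%R)).
transitivity (\int[leb]_x \int[leb]_u H (x, u)).
  apply: eq_integral => x _; rewrite muleC -ge0_integralZl//.
  exact: (measurableT_comp mG (pair1_measurable x)).
rewrite (fubini_tonelli (m1 := leb) (m2 := leb) H)//; last by move=> p; rewrite mule_ge0.
have mfr : measurable_fun setT (fun u => f (r * u)%R) by exact: measurableT_comp.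
rewrite (ge0_integral_normal_prob 0 1 _ mfr)//.
apply: eq_integral => u _.
transitivity (\int[leb]_x (f (r * u)%R * (normal_pdf 0 1 u)%:E * (normal_pdf (a * u / r) (`|b| / r) x)%:E)).
  apply: eq_integral => x _.
  rewrite /H /G /= muleCA [X in _ * X]muleCA [LHS]muleCA -muleA; congr (_ * _).
  by rewrite -!EFinM -/r normal_pdf01_convolution.
rewrite ge0_integralZl//; [|exact: mp|by rewrite mule_ge0].
by rewrite integral_normal_pdf mule1.
Qed.

(** * Integrals by antiderivatives, layer cake and radial moments *)

Lemma ge0_integral_FTCy (f F : R -> R) (a l : R) :
  (forall x : R, is_derive x (1 : R)%R F (f x)) -> continuous f ->
  (forall x, a <= x -> 0 <= f x)%R -> F x @[x --> +oo%R] --> l ->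
  \int[leb]_(x in `[a, +oo[) (f x)%:E = (l - F a)%:E.
Proof.
move=> dF cf f0 Fl.
have cF : continuous F.
  by move=> x; apply/differentiable_continuous/derivable1_diffP; apply: ex_derive.
rewrite (@ge0_continuous_FTC2y _ f F a l)//.
- exact: continuous_subspaceT.
- by apply: cvg_at_right_filter; exact: cF.
- by move=> x _; rewrite derive1E; apply: derive_val.
Qed.

Lemma integral_FTC (f F : R -> R) (a b : R) : (a < b)%R ->
  (forall x : R, is_derive x (1 : R)%R F (f x)) -> continuous f ->
  \int[leb]_(x in `[a, b]) (f x)%:E = (F b - F a)%:E.
Proof.
move=> ab dF cf.
have cF : continuous F.
  by move=> x; apply/differentiable_continuous/derivable1_diffP; apply: ex_derive.
rewrite (@continuous_FTC2 _ f F a b)//.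
- exact: continuous_subspaceT.
- split.
  + by move=> x _; apply: ex_derive.
  + by apply: cvg_at_right_filter; exact: cF.
  + by apply: cvg_at_left_filter; exact: cF.
- by move=> x _; rewrite derive1E; apply: derive_val.
Qed.

Lemma is_derive_gauss (x : R) :
  is_derive x (1 : R)%R (fun x : R => - expR (- x ^+ 2 / 2))%R (x * expR (- x ^+ 2 / 2))%R.
Proof.
apply: is_derive_eq.
have sc (k v : R) : (k *: (v : R^o) = k * v)%R by [].
by rewrite !sc; field.
Qed.

Lemma continuous_gauss_half : continuous (fun x : R => expR (- x ^+ 2 / 2))%R.
Proof.
move=> x; apply: continuous_comp; last exact: continuous_expR.
by apply: cvgM; [apply: cvgN; exact: exprn_continuous|exact: cvg_cst].
Qed.

Lemma cvg_gauss_half : (expR (- x ^+ 2 / 2) @[x --> +oo] --> (0 : R))%R.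
Proof.
under eq_fun do rewrite mulNr.
apply: (cvg_comp (fun x => x ^+ 2 / 2)%R (fun x => expR (- x))%R); last exact: cvgr_expR.
by apply: gt0_cvgMly => //; exact: cvgr_expr2.
Qed.

Lemma integral_gauss_tail (y : R) :
  (0 <= y)%R -> \int[leb]_(r in `[y, +oo[) (r * expR (- r ^+ 2 / 2))%:E = (expR (- y ^+ 2 / 2))%:E.
Proof.
move=> y0; rewrite (ge0_integral_FTCy _ _ _ 0%R is_derive_gauss).
- by rewrite sub0r opprK.
- move=> x; apply: cvgM; [exact: cvg_id|exact: continuous_gauss_half].
- by move=> x yx; rewrite mulr_ge0 ?expR_ge0// (le_trans y0).
- by rewrite -oppr0; apply: cvgN; exact: cvg_gauss_half.
Qed.

(** On [r >= 0] the derivative of [- e^(-r^2/2)]; the cut at 0 makes it nonnegative on the whole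
    line, as Tonelli requires. *)
Definition gauss_weight (r : R) : R := (Num.max 0 r * expR (- r ^+ 2 / 2))%R.

Lemma gauss_weight_ge0 r : (0 <= gauss_weight r)%R.
Proof. by rewrite mulr_ge0 ?expR_ge0// le_max lexx. Qed.

Lemma measurable_gauss_half : measurable_fun setT (fun x : R => expR (- x ^+ 2 / 2))%R.
Proof. by apply: continuous_measurable_fun; exact: continuous_gauss_half. Qed.

Lemma measurable_gauss_weight : measurable_fun setT gauss_weight.
Proof.
by apply: measurable_funM; [exact: measurable_maxr|exact: measurable_gauss_half].
Qed.

Lemma integral_gauss_weight (y : R) : (0 <= y)%R ->
  \int[leb]_r (if (y <= r)%R then (gauss_weight r)%:E else 0) = (expR (- y ^+ 2 / 2))%:E.
Proof.
move=> y0; rewrite -integral_gauss_tail// [RHS]integral_mkcond.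
apply: eq_integral => r _; rewrite patchE mem_setE in_itv/= andbT.
by case: ifPn => // yr; rewrite /gauss_weight max_r// (le_trans y0).
Qed.

(* Layer cake: e^(-g^2/2) is the integral of r e^(-r^2/2) over r >= g. *)
Lemma gauss_layer_cake d (X : measurableType d) (m : {sigma_finite_measure set X -> \bar R})
    (g : X -> R) (h : X -> \bar R) :
  measurable_fun setT g -> (forall x, 0 <= g x)%R ->
  measurable_fun setT h -> (forall x, 0 <= h x) ->
  \int[m]_x (h x * (expR (- g x ^+ 2 / 2))%:E) =
  \int[leb]_r ((gauss_weight r)%:E * \int[m]_x (if (g x <= r)%R then h x else 0)).
Proof.
move=> mg g0 mh h0.
pose H (p : X * R) := if (g p.1 <= p.2)%R then (gauss_weight p.2)%:E * h p.1 else 0.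
have mw : measurable_fun setT (fun r : R => (gauss_weight r)%:E).
  by apply/measurable_EFinP; exact: measurable_gauss_weight.
have mH : measurable_fun setT H.
  apply: measurable_fun_ifT => //.
    by apply: measurable_fun_ler => //; exact: measurableT_comp.
  by apply: emeasurable_funM; [exact: (measurableT_comp mw)|exact: (measurableT_comp mh)].
have H0 p : 0 <= H p.
  by rewrite /H; case: ifPn => // _; rewrite mule_ge0// lee_fin gauss_weight_ge0.
transitivity (\int[m]_x \int[leb]_r H (x, r)).
  apply: eq_integral => x _; rewrite -integral_gauss_weight// -ge0_integralZl//.
  - by apply: eq_integral => r _; rewrite /H/=; case: ifPn => _; rewrite ?mule0// muleC.
  - by apply: measurable_fun_ifT => //; exact: measurable_fun_ler.
  - by move=> r _; case: ifPn => // _; rewrite lee_fin gauss_weight_ge0.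
rewrite (fubini_tonelli (m1 := m) (m2 := leb) H)//.
apply: eq_integral => r _; rewrite -ge0_integralZl ?lee_fin ?gauss_weight_ge0//.
- by apply: eq_integral => x _; rewrite /H/=; case: ifPn => _; rewrite ?mule0.
- by apply: measurable_fun_ifT => //; exact: measurable_fun_ler.
- by move=> x _; case: ifPn.
Qed.

(** Equal to [2^((k-1)/2) Gamma((k+1)/2)]; kept in [\bar R], which avoids finiteness side
    conditions. *)
Definition gauss_moment k : \bar R :=
  \int[leb]_(r in `[0%R, +oo[) (r ^+ k * expR (- r ^+ 2 / 2))%:E.

Lemma gauss_moment1 : gauss_moment 1 = 1.
Proof. by rewrite /gauss_moment integral_gauss_tail// expr0n/= oppr0 mul0r expR0. Qed.

Lemma integral_monomial k (r : R) : (0 <= r)%R ->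
  \int[leb]_(x in `[0%R, r]) (k.+1%:R * x ^+ k)%:E = (r ^+ k.+1)%:E.
Proof.
rewrite le_eqVlt => /predU1P[<-|r0].
  by rewrite set_itv1 integral_set1 expr0n.
have dX (x : R) : is_derive x (1 : R)%R (fun x : R => x ^+ k.+1)%R (k.+1%:R * x ^+ k)%R.
  apply: DeriveDef; first exact: exprn_derivable.
  rewrite exp_derive; exact: mulr1.
rewrite (integral_FTC _ _ _ _ r0 dX).
- by rewrite expr0n subr0.
- move=> x; apply: cvgM; [exact: cvg_cst|exact: exprn_continuous].
Qed.

(** Integration by parts in the form of the layer cake for [h x = (k+1) x^k] on [x >= 0]: the part
    of [h] below [r] has integral [r^(k+1)], and the layer weight adds one factor [r]. No boundary
    term arises. *)
Lemma gauss_momentSS k : gauss_moment k.+2 = k.+1%:R%:E * gauss_moment k.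
Proof.
pose h (x : R) := if (0 <= x)%R then (k.+1%:R * x ^+ k)%:E else 0.
have mh : measurable_fun setT h.
  apply: measurable_fun_ifT => //; first exact: measurable_fun_ler.
  by apply/measurable_EFinP; exact: measurable_funM.
have h0 x : 0 <= h x.
  by rewrite /h; case: ifPn => // x0; rewrite lee_fin mulr_ge0// exprn_ge0.
transitivity (\int[leb]_x (h x * (expR (- `|x| ^+ 2 / 2))%:E)).
  rewrite (gauss_layer_cake _ _ leb (fun x => `|x|)%R h)//; last first.
    by apply: continuous_measurable_fun; exact: norm_continuous.
  rewrite /gauss_moment integral_mkcond; apply: eq_integral => r _.
  rewrite patchE mem_setE in_itv/= andbT; case: ifPn => r0; last first.
    by rewrite /gauss_weight max_l ?mul0r ?mul0e// ltW// ltNge.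
  rewrite (_ : \int[leb]_x _ = (r ^+ k.+1)%:E).
    by rewrite -EFinM /gauss_weight max_r//; congr EFin; rewrite [(_ ^+ k.+2)%R]exprSr; ring.
  rewrite -integral_monomial// [RHS]integral_mkcond; apply: eq_integral => x _.
  rewrite patchE mem_setE in_itv/= /h ler_norml.
  have [x0|x0] := leP 0%R x; rewrite ?andbF//=; last by case: ifP.
  by rewrite (le_trans _ x0) ?oppr_le0//=.
rewrite /gauss_moment [X in _ = _ * X]integral_mkcond -ge0_integralZl//.
- apply: eq_integral => x _; rewrite patchE mem_setE in_itv/= andbT /h.
  by case: ifPn => _; rewrite ?mul0e ?mule0// real_normK ?num_real// -!EFinM mulrA.
- apply/(measurable_restrictT _ _).1 => //; apply/measurable_EFinP; apply: measurable_funM => //.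
  exact: measurable_funS measurable_gauss_half.
- move=> x _; rewrite patchE mem_setE in_itv/= andbT; case: ifPn => // x0.
  by rewrite lee_fin mulr_ge0 ?exprn_ge0 ?expR_ge0.
Qed.

Lemma gauss_moment3 : gauss_moment 3 = 2%:E.
Proof. by rewrite gauss_momentSS gauss_moment1 mule1. Qed.

Lemma gauss_moment5 : gauss_moment 5 = 8%:E.
Proof. by rewrite gauss_momentSS gauss_moment3 -EFinM; congr EFin; ring. Qed.

(* AM-GM: [r ^+ 4 <= r ^+ 3 + r ^+ 5 / 4], which is sharp enough to start the
   Stirling-type induction at odd dimensions without an estimate of [pi]. *)
Lemma gauss_moment4_le : gauss_moment 4 <= 4%:E.
Proof.
have mk k : measurable_fun (`[0%R, +oo[%classic : set R) (fun r : R => (r ^+ k * expR (- r ^+ 2 / 2))%:E).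
  apply/measurable_EFinP; apply: measurable_funTS; apply: measurable_funM => //.
  exact: measurable_gauss_half.
have k0 k (x : R) : `[0%R, +oo[%classic x -> 0 <= (x ^+ k * expR (- x ^+ 2 / 2))%:E.
  by rewrite /= in_itv/= andbT => x0; rewrite lee_fin mulr_ge0 ?exprn_ge0 ?expR_ge0.
have -> : 4%:E = gauss_moment 3 + (4^-1)%R%:E * gauss_moment 5.
  by rewrite gauss_moment3 gauss_moment5 -EFinM -EFinD; congr EFin; field.
rewrite /gauss_moment -ge0_integralZl//; [|exact: mk|exact: k0].
rewrite -ge0_integralD//; first last.
- by apply: emeasurable_funM => //; exact: mk.
- by move=> x x0; rewrite mule_ge0// k0.
- exact: mk.
- exact: k0.
apply: ge0_le_integral => //.
- exact: k0.
- exact: mk.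
- apply: emeasurable_funD; first exact: mk.
  by apply: emeasurable_funM => //; exact: mk.
- move=> x; rewrite /= in_itv/= andbT => x0.
  rewrite -EFinM -EFinD lee_fin mulrA -mulrDl ler_wpM2r ?expR_ge0// -subr_ge0.
  have -> : (x ^+ 3 + 4^-1 * x ^+ 5 - x ^+ 4 = x ^+ 3 * (1 - x / 2) ^+ 2)%R by field.
  by rewrite mulr_ge0 ?sqr_ge0 ?exprn_ge0.
Qed.

Lemma integral_normal_even (f : R -> R) : (forall x, 0 <= f x)%R -> continuous f ->
  (forall x, f (- x) = f x)%R ->
  \int[N01]_x (f x)%:E = (2 / Num.sqrt (pi *+ 2))%R%:E *
    \int[leb]_(x in `[0%R, +oo[) (f x * expR (- x ^+ 2 / 2))%:E.
Proof.
move=> f0 cf fN.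
have mf : measurable_fun setT (fun x => (f x)%:E).
  by apply/measurable_EFinP; exact: continuous_measurable_fun.
rewrite (ge0_integral_normal_prob 0 1 (fun x => (f x)%:E) mf)//.
under eq_integral do rewrite -EFinM.
rewrite (ge0_symfun_integralT (f := fun x => f x * normal_pdf 0 1 x)%R).
- rewrite EFinM -muleA; congr (_ * _).
  rewrite -ge0_integralZl ?lee_fin ?invr_ge0//.
  + rewrite set_itvcy; apply: eq_integral => x _.
    by rewrite -EFinM normal_pdf01; congr EFin; ring.
  + apply/measurable_EFinP; apply: measurable_funTS; apply: measurable_funM.
      exact: continuous_measurable_fun.
    exact: measurable_gauss_half.
  + by move=> x _; rewrite lee_fin mulr_ge0// expR_ge0.
- by move=> x; rewrite mulr_ge0// normal_pdf_ge0.
- by move=> x; apply: cvgM; [exact: cf|apply: continuous_normal_pdf; exact: oner_neq0].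
- by move=> x /=; rewrite fN !normal_pdf01 sqrrN.
Qed.

Lemma integral_normal_abs : \int[N01]_x (`|x|)%:E = (2 / Num.sqrt (pi *+ 2))%R%:E.
Proof.
rewrite integral_normal_even//; [|exact: norm_continuous|by move=> x; rewrite normrN].
rewrite -[RHS]mule1 -gauss_moment1; congr (_ * _).
apply: eq_integral => x; rewrite mem_setE in_itv/= andbT => x0.
by rewrite ger0_norm// expr1.
Qed.

(** The recursion reduces the second moment to the zeroth, which is normalised by the total mass 1,
    so the Gaussian integral itself is not evaluated. *)
Lemma integral_normal_sqr : \int[N01]_x (x ^+ 2)%:E = 1.
Proof.
rewrite integral_normal_even//; [|by move=> x; exact: sqr_ge0|exact: exprn_continuous|by move=> x; rewrite sqrrN].
rewrite -/(gauss_moment 2) gauss_momentSS mul1e.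
transitivity (\int[N01]_x (1%R)%:E); last by rewrite integral_cst//= mul1e; exact: probability_setT.
rewrite (integral_normal_even (fun=> 1%R))//; last by move=> x; exact: cvg_cst.
Qed.

End OneDim.

(** * Standard Gaussian vectors *)

Section GaussVec.
Import numFieldNormedType.Exports.
Context {R : realType}.
Local Open Scope ereal_scope.
Local Notation N01 := (normal_prob 0%R (1%R : R)).

Definition cons_tuple n (p : measurableTypeR R * n.-tuple R) : n.+1.-tuple R :=
  [tuple of p.1 :: p.2].

Lemma measurable_cons_tuple n : measurable_fun setT (@cons_tuple n).
Proof.
by apply: (@measurable_cons _ _ (measurableTypeR R * n.-tuple R)%type R fst n snd).
Qed.

HB.instance Definition _ n := isMeasurableFun.Build _ _ _ _ (@cons_tuple n) (@measurable_cons_tuple n).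

(** Coordinates are added at the head, as in [iter_gauss], so the two integrals can be compared one
    variable at a time. *)
Fixpoint gauss_vec (n : nat) : probability (n.-tuple R) R :=
  match n with
  | 0 => \d_([tuple] : 0.-tuple R)
  | m.+1 => distribution (N01 \x gauss_vec m)%E (@cons_tuple m)
  end.

(** [iter_gauss] takes functions of sequences of any length; measurability is asked only on tuples
    of the length in use. *)
Definition measurable_seq n (f : seq R -> \bar R) :=
  measurable_fun setT (fun t : n.-tuple R => f t).

Lemma measurable_seq_cons n f : measurable_seq n.+1 f ->
  measurable_fun setT (fun p : R * n.-tuple R => f (p.1 :: p.2)).
Proof. by move=> mf; exact: (measurableT_comp mf (@measurable_cons_tuple n)). Qed.

Lemma measurable_seq_cons1 n f x : measurable_seq n.+1 f ->
  measurable_seq n (fun l => f (x :: l)).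
Proof.
move=> /measurable_seq_cons mf.
exact: (measurableT_comp mf (pair1_measurable x)).
Qed.

Lemma measurable_map n (c : R) :
  measurable_fun setT (fun t : n.-tuple R => [tuple of map ( *%R c) t]).
Proof.
apply/measurable_fun_tnthP => i.
rewrite (_ : _ \o _ = fun t => c * tnth t i)%R; last by apply/funext => t /=; rewrite tnth_map.
by apply: measurable_funM => //; exact: measurable_tnth.
Qed.

Lemma measurable_seq_map n (c : R) f : measurable_seq n f ->
  measurable_seq n (fun l => f (map ( *%R c) l)).
Proof. by move=> mf; exact: (measurableT_comp mf (@measurable_map n c)). Qed.

Lemma measurable_nth n (i : 'I_n) : measurable_fun setT (fun t : n.-tuple R => t`_i)%R.
Proof.
rewrite (_ : (fun _ => _) = (@tnth n R ^~ i)); first exact: measurable_tnth.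
by apply/funext => t; rewrite (tnth_nth 0%R).
Qed.

Lemma integral_gauss_vec0 (f : seq R -> \bar R) : (forall l, 0 <= f l) ->
  \int[gauss_vec 0]_t f t = f [::].
Proof.
move=> f0 /=; rewrite integral_dirac//= ?diracT ?mul1e//.
rewrite (_ : (fun _ => _) = cst (f [::])); first exact: measurable_cst.
by apply/funext => t; rewrite tuple0.
Qed.

Lemma integral_gauss_vecS n (f : seq R -> \bar R) : measurable_seq n.+1 f ->
  (forall l, 0 <= f l) ->
  \int[gauss_vec n.+1]_t f t = \int[N01]_x \int[gauss_vec n]_t f (x :: t).
Proof.
move=> mf f0.
rewrite /= ge0_integral_pushforward//=.
rewrite (fubini_tonelli1 (m1 := N01) (m2 := gauss_vec n) (fun p => f (p.1 :: p.2)))//.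
exact: measurable_seq_cons.
Qed.

(** Rescaling each variable moves the standard deviation into the argument; measurability of the
    inner integral comes from Tonelli. *)
Lemma iter_gaussE (s : R) n (f : seq R -> \bar R) : (0 < s)%R -> measurable_seq n f ->
  (forall l, 0 <= f l) ->
  iter_gauss s n f = \int[gauss_vec n]_t f (map ( *%R s) t).
Proof.
move=> s0; elim: n f => [|n IH] f mf f0.
  by rewrite (integral_gauss_vec0 (fun l => f (map ( *%R s) l))).
rewrite (integral_gauss_vecS n (fun l => f (map ( *%R s) l)) (measurable_seq_map _ _ _ mf) (fun l => f0 _)).
pose A x := \int[gauss_vec n]_t f (x :: map ( *%R s) t).
transitivity (\int[normal_prob 0%R s]_x A x).
  by apply: eq_integral => x _; exact: (IH _ (measurable_seq_cons1 _ _ _ mf)).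
rewrite ge0_integral_normal_scale//; last by move=> x; exact: integral_ge0.
have mf' : measurable_fun setT (fun p : R * n.-tuple R => f (p.1 :: map ( *%R s) p.2)).
  have mp : measurable_fun setT (fun p : R * n.-tuple R => (p.1, [tuple of map ( *%R s) p.2])).
    by apply: measurable_fun_pair => //; exact: (measurableT_comp (@measurable_map n s)).
  exact: (measurableT_comp (measurable_seq_cons _ _ mf) mp).
exact: (measurable_fun_fubini_tonelli_F (m2 := gauss_vec n) _ mf').
Qed.

(** * Squared norm and linear forms of a Gaussian vector *)

Definition sqn n (l : seq R) : R := (\sum_(i < n) l`_i ^+ 2)%R.
Definition lin n (w : 'I_n -> R) (l : seq R) : R := (\sum_(i < n) w i * l`_i)%R.

Lemma sqn_ge0 n l : (0 <= sqn n l)%R.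
Proof. by apply: sumr_ge0 => i _; exact: sqr_ge0. Qed.

Lemma measurable_sqn n : measurable_fun setT (fun t : n.-tuple R => sqn n t).
Proof. by apply: measurable_sum => i; apply: measurable_funX; exact: measurable_nth. Qed.

Lemma measurable_lin n (w : 'I_n -> R) : measurable_fun setT (fun t : n.-tuple R => lin n w t).
Proof. by apply: measurable_sum => i; apply: measurable_funM => //; exact: measurable_nth. Qed.

Lemma sqn_cons n x l : sqn n.+1 (x :: l) = (x ^+ 2 + sqn n l)%R.
Proof. by rewrite /sqn big_ord_recl. Qed.

Lemma lin_cons n w x l : lin n.+1 w (x :: l) = (w ord0 * x + lin n (fun i => w (lift ord0 i)) l)%R.
Proof. by rewrite /lin big_ord_recl. Qed.

(** True past the end of [l] too, where the default value 0 is fixed by scaling. *)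
Lemma nth_scale (c : R) (l : seq R) i : ((map ( *%R c) l)`_i = c * l`_i)%R.
Proof.
have [il|il] := ltnP i (size l); first by rewrite (nth_map 0%R).
by rewrite !nth_default ?mulr0// size_map.
Qed.

Lemma sqn_scale n c l : sqn n (map ( *%R c) l) = (c ^+ 2 * sqn n l)%R.
Proof. by rewrite /sqn mulr_sumr; apply: eq_bigr => i _; rewrite nth_scale exprMn. Qed.

Lemma lin_scale n w c l : lin n w (map ( *%R c) l) = (c * lin n w l)%R.
Proof. by rewrite /lin mulr_sumr; apply: eq_bigr => i _; rewrite nth_scale mulrCA. Qed.

Lemma measurable_expR_sqn n (k : R) : measurable_seq n (fun l => (expR (k * sqn n l))%:E).
Proof.
apply/measurable_EFinP; apply: measurableT_comp => //; apply: measurable_funM => //.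
exact: measurable_sqn.
Qed.

Lemma measurable_seqM n f g : measurable_seq n f -> measurable_seq n g ->
  measurable_seq n (fun l => f l * g l).
Proof. exact: emeasurable_funM. Qed.

(** Homogeneity of Lebesgue measure on [R^n], by induction: the weight is a product over
    coordinates, and each contributes one factor [1 / |c|]. *)
Lemma ge0_integral_gauss_vec_tilt n (c : R) (h : seq R -> \bar R) : (c != 0)%R ->
  measurable_seq n h -> (forall l, 0 <= h l) ->
  \int[gauss_vec n]_t (h (map ( *%R c) t) * (expR (2^-1 * sqn n t))%:E) =
  ((`|c| ^+ n)^-1)%:E * \int[gauss_vec n]_t (h t * (expR (2^-1 * sqn n t))%:E).
Proof.
move=> c0; elim: n h => [|n IH] h mh h0.
  by rewrite !(integral_gauss_vec0 (fun l => h (map ( *%R c) l) * (expR (2^-1 * sqn 0 l))%:E))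
     ?(integral_gauss_vec0 (fun l => h l * (expR (2^-1 * sqn 0 l))%:E)) ?expr0 ?invr1 ?mul1e// => l;
  rewrite mule_ge0// lee_fin expR_ge0.
have eg0 k m l : 0 <= (expR (k * sqn m l))%:E by rewrite lee_fin expR_ge0.
rewrite (integral_gauss_vecS n (fun l => h (map ( *%R c) l) * (expR (2^-1 * sqn n.+1 l))%:E)); first last.
- by move=> l; rewrite mule_ge0.
- by apply: measurable_seqM; [exact: measurable_seq_map|exact: measurable_expR_sqn].
rewrite (integral_gauss_vecS n (fun l => h l * (expR (2^-1 * sqn n.+1 l))%:E)); first last.
- by move=> l; rewrite mule_ge0.
- by apply: measurable_seqM => //; exact: measurable_expR_sqn.
pose A y := \int[gauss_vec n]_t (h (y :: t) * (expR (2^-1 * sqn n t))%:E).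
have A0 y : 0 <= A y by apply: integral_ge0 => t _; rewrite mule_ge0.
have mA : measurable_fun setT A.
  apply: (measurable_fun_fubini_tonelli_F (m2 := gauss_vec n)
    (fun p => h (p.1 :: p.2) * (expR (2^-1 * sqn n p.2))%:E)) => //; last first.
    by move=> p; rewrite mule_ge0.
  apply: emeasurable_funM; first exact: measurable_seq_cons.
  exact: (measurableT_comp (measurable_expR_sqn n 2^-1)).
have mh1 y : measurable_seq n (fun l => h (y :: l)) by exact: measurable_seq_cons1.
have ex x l : (expR (2^-1 * sqn n.+1 (x :: l)))%:E = (expR (x ^+ 2 / 2))%:E * (expR (2^-1 * sqn n l))%:E.
  by rewrite -EFinM -expRD sqn_cons mulrDr [(2^-1 * (_ ^+ _))%R]mulrC.
have split (H : seq R -> \bar R) x : measurable_seq n H -> (forall l, 0 <= H l) ->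
    \int[gauss_vec n]_t (H t * (expR (2^-1 * sqn n.+1 (x :: t)))%:E) =
    \int[gauss_vec n]_t (H t * (expR (2^-1 * sqn n t))%:E) * (expR (x ^+ 2 / 2))%:E.
  move=> mH H0; rewrite muleC -ge0_integralZl ?lee_fin ?expR_ge0//.
  - by apply: eq_integral => t _; rewrite ex muleCA.
  - exact: (measurable_seqM _ _ _ mH (measurable_expR_sqn _ _)).
  - by move=> t _; rewrite mule_ge0.
(* The induction hypothesis scales the tail of the vector; the one-variable tilt below scales its
   head. *)
transitivity (\int[N01]_x ((`|c| ^+ n)^-1%:E * A (c * x)%R * (expR (x ^+ 2 / 2))%:E)).
  apply: eq_integral => x _.
  rewrite (split (fun l => h (c * x :: map ( *%R c) l)%R))//; last first.
    exact: (measurable_seq_map _ _ _ (mh1 _)).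
  by rewrite (IH (fun l => h (c * x :: l)%R)).
rewrite (ge0_integral_normal_tilt c (fun y => (`|c| ^+ n)^-1%:E * A y))//; first last.
- by move=> y; rewrite mule_ge0// lee_fin invr_ge0 exprn_ge0.
- by apply: emeasurable_funM.
transitivity (`|c|^-1%:E * \int[N01]_x ((`|c| ^+ n)^-1%:E * (A x * (expR (x ^+ 2 / 2))%:E))).
  by congr (_ * _); apply: eq_integral => x _; rewrite muleA.
rewrite ge0_integralZl//; first last.
- by move=> x _; rewrite mule_ge0// lee_fin expR_ge0.
- apply: emeasurable_funM => //; apply/measurable_EFinP; apply: measurableT_comp => //.
  by apply: measurable_funM => //; exact: measurable_funX.
rewrite muleA -EFinM -invfM -exprS; congr (_ * _).
by apply: eq_integral => x _; rewrite (split (fun l => h (x :: l))).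
Qed.

(** Each new coordinate is absorbed by the two-variable addition formula, under which standard
    deviations add in squares. *)
Lemma ge0_integral_gauss_vec_lin n (w : 'I_n -> R) (f : R -> \bar R) :
  measurable_fun setT f -> (forall x, 0 <= f x) ->
  \int[gauss_vec n]_t f (lin n w t) =
  \int[N01]_x f (Num.sqrt (\sum_(i < n) w i ^+ 2) * x)%R.
Proof.
elim: n w f => [|n IH] w f mf f0.
  rewrite (integral_gauss_vec0 (fun l => f (lin 0 w l)))// /lin big_ord0.
  under eq_integral do rewrite big_ord0 sqrtr0 mul0r.
  by rewrite integral_cst//= [X in _ * X](_ : _ = 1) ?mule1//; exact: probability_setT.
rewrite (integral_gauss_vecS n (fun l => f (lin n.+1 w l)))//; last first.
  exact: (measurableT_comp mf (measurable_lin n.+1 w)).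
pose v i := w (lift ord0 i).
have mw x : measurable_fun setT (fun y => f (w ord0 * x + y)%R).
  by apply: (measurableT_comp mf); exact: measurable_funD.
transitivity (\int[N01]_x \int[N01]_y f (w ord0 * x + Num.sqrt (\sum_(i < n) v i ^+ 2) * y)%R).
  apply: eq_integral => x _.
  under eq_integral do rewrite lin_cons.
  by rewrite (IH _ (fun y => f (w ord0 * x + y)%R)).
rewrite ge0_integral_normal_add//.
by rewrite sqr_sqrtr ?big_ord_recl// sumr_ge0// => i _; exact: sqr_ge0.
Qed.

End GaussVec.

(** * Elementary estimates *)

Section Numeric.
Import numFieldNormedType.Exports.
Context {R : realType}.

Lemma is_derive_ler (f f' : R -> R) (a b : R) : a <= b ->
  (forall x : R, is_derive x (1 : R) f (f' x)) ->
  (forall x, a < x < b -> 0 <= f' x) -> f a <= f b.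
Proof.
move=> ab df f'0.
apply: (@ger0_derive1_ndecr _ f a b) => //.
- by move=> x; rewrite in_itv/= => xab; rewrite derive1E derive_val f'0.
- apply: continuous_subspaceT => x.
  by apply/differentiable_continuous/derivable1_diffP; apply: ex_derive.
Qed.

(** The difference [(1 + x) e^(-x) - (1 - x) e^x] vanishes at 0 and has derivative
    [x (e^x - e^(-x)) >= 0]. At [y = 1 / (k + 1)] the right side is [(k + 2) / k], the growth that
    the Stirling induction needs. *)
Lemma expR_le_cayley (y : R) : 0 <= y < 1 -> expR (2 * y) <= (1 + y) / (1 - y).
Proof.
move=> /andP[y0 y1].
pose f (x : R) := (1 + x) * expR (- x) - (1 - x) * expR x.
have df (x : R) : is_derive x (1 : R) f (x * (expR x - expR (- x))).
  apply: is_derive_eq.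
  have sc (k v : R) : (k *: (v : R^o) = k * v)%R by [].
  by rewrite !sc; ring.
have := is_derive_ler f _ 0 y y0 df.
rewrite {1}/f oppr0 expR0 !addr0 subrr => f0.
have {f0} : 0 <= f y.
  apply: f0 => x /andP[x0 _]; rewrite mulr_ge0 ?(ltW x0)// subr_ge0 ler_expR; lra.
rewrite /f subr_ge0 => H.
rewrite ler_pdivlMr ?subr_gt0//.
have -> : 2 * y = y + y by ring.
rewrite expRD -mulrA.
have := ler_wpM2l (expR_ge0 y) H.
rewrite [expR y * (_ * expR (- y))]mulrCA -expRD subrr expR0 mulr1 => /(le_trans _); apply.
by rewrite [(1 - y) * _]mulrC.
Qed.

(** The derivative of [- (1 + x) e^(-(x - x^2/4))] is a positive multiple of [x (1 - x)]. The
    quadratic term is what turns the Chernoff bound into [e^(-d eps^2/8)]. *)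
Lemma one_plus_le_expR (e : R) : 0 <= e <= 1 -> 1 + e <= expR (e - e ^+ 2 / 4).
Proof.
move=> /andP[e0 e1].
pose f (x : R) := - ((1 + x) * expR (- (x - x ^+ 2 / 4))).
have df (x : R) : is_derive x (1 : R) f (expR (- (x - x ^+ 2 / 4)) * (x / 2 * (1 - x))).
  apply: is_derive_eq.
  have sc (k v : R) : (k *: (v : R^o) = k * v)%R by [].
  by rewrite !sc; field.
have := is_derive_ler f _ 0 e e0 df.
rewrite {1}/f expr0n/= mul0r subr0 oppr0 expR0 addr0 mulr1 => f0.
have {f0} : -1 <= f e.
  apply: f0 => x /andP[x0 x1]; rewrite mulr_ge0 ?expR_ge0// mulr_ge0//; lra.
rewrite /f lerN2 expRN => H.
by rewrite -[leRHS]mul1r -ler_pdivrMr ?expR_gt0.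
Qed.

(** From [k] to [k + 2] the moment gains the factor [k + 2] while the bound gains
    [(k + 2) q^(k+1) / e] with [q^2 = (k + 2) / k], so the step is [e^(2/(k+1)) <= (k + 2) / k]. It
    keeps parity, hence the base cases 2 and 3; at [n = 1] the inequality fails. *)
Lemma gauss_moment_le n : (2 <= n)%N ->
  (gauss_moment n.+1 <= (2 * Num.sqrt n%:R ^+ n.+1 * expR (- (n%:R / 2)))%:E :> \bar R)%E.
Proof.
have step k : (2 <= k)%N ->
  (gauss_moment k.+1 <= (2 * Num.sqrt k%:R ^+ k.+1 * expR (- (k%:R / 2)))%:E :> \bar R)%E ->
  (gauss_moment k.+3 <= (2 * Num.sqrt k.+2%:R ^+ k.+3 * expR (- (k.+2%:R / 2)))%:E :> \bar R)%E.
  move=> k2 IH.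
  have k0 : (0 < k%:R :> R) by rewrite ltr0n (leq_trans _ k2).
  pose q := Num.sqrt ((k%:R + 2) / k%:R : R).
  have q0 : 0 <= q by exact: sqrtr_ge0.
  have sk : Num.sqrt k.+2%:R = q * Num.sqrt (k%:R : R).
    rewrite /q -sqrtrM; last by rewrite divr_ge0 ?addr_ge0 ?ler0n.
    by rewrite divfK ?gt_eqF// -natrD addn2.
  have qe : expR (1 : R) <= q ^+ k.+1.
    have -> : (1 : R) = k.+1%:R * (k.+1%:R)^-1 by rewrite mulfV.
    rewrite expRM_natl lerXn2r ?nnegrE ?expR_ge0//.
    rewrite -(ler_pXn2r (n:=2)) ?nnegrE ?expR_ge0// -expRM_natl sqr_sqrtr ?divr_ge0 ?addr_ge0 ?ler0n//.
    apply: (le_trans (expR_le_cayley _ _)).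
      by rewrite invr_ge0 ler0n/= invf_lt1 ?ltr0n// ltr1n ltnS (leq_trans _ k2).
    rewrite le_eqVlt; apply/orP; left; apply/eqP; rewrite -natr1; field.
    by rewrite gt_eqF//= natr1 -(natrB _ (leq0n _))?subn0 !pnatr_eq0/= gtn_eqF// (leq_trans _ k2).
  rewrite gauss_momentSS.
  apply: (le_trans (lee_wpmul2l _ IH)); first by rewrite lee_fin ler0n.
  rewrite -EFinM lee_fin.
  have -> : - (k.+2%:R / 2) = - (k%:R / 2) + - 1 :> R by rewrite -addn2 natrD; field.
  rewrite expRD [expR (- 1)]expRN.
  have -> : Num.sqrt k.+2%:R ^+ k.+3 = k.+2%:R * (q ^+ k.+1 * Num.sqrt (k%:R : R) ^+ k.+1).
    by rewrite 2!exprS mulrA -expr2 sqr_sqrtr ?ler0n// sk exprMn.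
  set E := expR (- _); set S := Num.sqrt _ ^+ _.
  have -> : 2 * (k.+2%:R * (q ^+ k.+1 * S)) * (E / expR 1) =
     k.+2%:R * (2 * S * E) * (q ^+ k.+1 / expR 1) by ring.
  by rewrite ler_peMr ?mulr_ge0 ?ler0n ?exprn_ge0 ?sqrtr_ge0 ?expR_ge0// ler_pdivlMr ?expR_gt0// mul1r.
(* The case [n = 3] asks for [e^(3/2) <= 9/2], while [e^(3/2)] is about 4.48. Squaring
   [e^(1/8) <= 17/15] twice gives [e^(1/2) <= 33/20], whose cube is still below 9/2. *)
have e8 : expR (1 / 8 : R) <= 17 / 15.
  have := expR_le_cayley (1 / 16 : R); rewrite (_ : 2 * (1 / 16) = 1 / 8 :> R); last by field.
  have -> : (1 + 1 / 16) / (1 - 1 / 16) = 17 / 15 :> R by field.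
  by apply; lra.
have e4 : expR (1 / 2 : R) <= 33 / 20.
  have -> : 1 / 2 = 4%:R * (1 / 8) :> R by field.
  rewrite expRM_natl (exprM _ 2 2).
  have e0 := expR_ge0 (1 / 8 : R).
  have h : expR (1 / 8 : R) ^+ 2 <= 289 / 225 by rewrite expr2; nra.
  have h0 := sqr_ge0 (expR (1 / 8 : R)).
  by rewrite [leLHS]expr2; nra.
have e0 := expR_ge0 (1 / 2 : R).
have pos := expR_gt0 (1 / 2 : R).
elim/ltn_ind: n => -[//|[//|[_ _|[_ _|n IH _]]]].
- rewrite gauss_moment3 lee_fin.
  have -> : 2%:R / 2 = 2%:R * (1 / 2) :> R by field.
  rewrite expRN expRM_natl ler_pdivlMr ?exprn_gt0//.
  rewrite ler_pM2l// [Num.sqrt _ ^+ 3]exprSr sqr_sqrtr ?ler0n//.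
  have : (7 / 5 : R) <= Num.sqrt 2%:R.
    by rewrite -[leLHS]ger0_norm; [rewrite -sqrtr_sqr ler_sqrt; lra|lra].
  by rewrite expr2; nra.
- apply: (le_trans gauss_moment4_le); rewrite lee_fin.
  have -> : 3%:R / 2 = 3%:R * (1 / 2) :> R by field.
  rewrite expRN expRM_natl ler_pdivlMr ?exprn_gt0//.
  have -> : Num.sqrt 3%:R ^+ 4 = 9%:R :> R by rewrite (exprM _ 2 2) sqr_sqrtr ?ler0n//; ring.
  have h : expR (1 / 2 : R) ^+ 2 <= 1089 / 400 by rewrite expr2; nra.
  have h0 := sqr_ge0 (expR (1 / 2 : R)).
  by rewrite exprSr; nra.
- by apply: step => //; apply: IH.
Qed.

(** The convex function [u^((n+2)/2)] at [u = r^2] lies above its tangent at [r0^2]. This replaces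
    [r^d - r0^d] by a multiple of [r^2 - r0^2], whose Gaussian radial integral is elementary. *)
Lemma convex_pow_le (n : nat) (r r0 : R) : 0 < r0 -> r0 <= r ->
  n.+2%:R / 2 * r0 ^+ n * (r ^+ 2 - r0 ^+ 2) <= r ^+ n.+2 - r0 ^+ n.+2.
Proof.
move=> p rr; rewrite -subr_ge0; elim: n => [|n IH].
  by rewrite expr0 mulr1 divff// mul1r subrr.
have pr : 0 <= r by rewrite (le_trans (ltW p)).
have -> : r ^+ n.+3 - r0 ^+ n.+3 - n.+3%:R / 2 * r0 ^+ n.+1 * (r ^+ 2 - r0 ^+ 2) =
   r * (r ^+ n.+2 - r0 ^+ n.+2 - n.+2%:R / 2 * r0 ^+ n * (r ^+ 2 - r0 ^+ 2)) +
   r0 ^+ n * ((r - r0) ^+ 2 * (n.+2%:R * r + n.+1%:R * r0) / 2).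
  by rewrite -[n.+3]addn3 -[n.+2]addn2 -[n.+1]addn1 !exprD !natrD; field.
apply: addr_ge0; first by rewrite mulr_ge0.
rewrite mulr_ge0 ?exprn_ge0 ?(ltW p)// mulr_ge0// mulr_ge0 ?sqr_ge0// addr_ge0// mulr_ge0 ?ler0n// ltW//.
Qed.

End Numeric.

(** * Gaussian tails *)

Section GaussTail.
Import numFieldNormedType.Exports.
Context {R : realType}.
Local Open Scope ereal_scope.
Local Notation N01 := (normal_prob 0%R (1%R : R)).
Local Notation leb := (@lebesgue_measure R).
Local Notation P := (gauss_vec (R := R)).

Lemma integral_gauss_vec_abs_lin n (w : 'I_n -> R) :
  \int[P n]_t (`|lin n w t|)%:E =
  (Num.sqrt (\sum_(i < n) w i ^+ 2) * (2 / Num.sqrt (pi *+ 2)))%R%:E.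
Proof.
have mn : measurable_fun setT (fun x : R => (`|x|)%:E).
  by apply/measurable_EFinP; apply: continuous_measurable_fun; exact: norm_continuous.
rewrite (ge0_integral_gauss_vec_lin n w (fun x => (`|x|)%:E))//.
rewrite EFinM -integral_normal_abs -ge0_integralZl//.
by apply: eq_integral => x _; rewrite normrM ger0_norm.
Qed.

Lemma integral_gauss_vec_sqr_lin n (w : 'I_n -> R) :
  \int[P n]_t (lin n w t ^+ 2)%:E = (\sum_(i < n) w i ^+ 2)%:E.
Proof.
have mn : measurable_fun setT (fun x : R => (x ^+ 2)%:E).
  by apply/measurable_EFinP; exact: measurable_funX.
have s0 : (0 <= \sum_(i < n) w i ^+ 2)%R by apply: sumr_ge0 => i _; exact: sqr_ge0.
rewrite (ge0_integral_gauss_vec_lin n w (fun x => (x ^+ 2)%:E))//; last first.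
  by move=> x; rewrite lee_fin sqr_ge0.
rewrite -[RHS]mule1 -integral_normal_sqr -ge0_integralZl//.
- by apply: eq_integral => x _; rewrite exprMn sqr_sqrtr.
- by move=> x _; rewrite lee_fin sqr_ge0.
Qed.

Lemma ge0_integral_gauss_vec_opp n (f : seq R -> \bar R) :
  measurable_seq n f -> (forall l, 0 <= f l) ->
  \int[P n]_t f (map ( *%R (-1)%R) t) = \int[P n]_t f t.
Proof.
move=> mf f0.
pose h l := f l * (expR (- 2^-1 * sqn n l))%:E.
have mh : measurable_seq n h by apply: measurable_seqM => //; exact: measurable_expR_sqn.
have h0 l : 0 <= h l by rewrite mule_ge0// lee_fin expR_ge0.
have N10 : (-1 != 0 :> R)%R by rewrite oppr_eq0 oner_eq0.
have E l l' : sqn n l = sqn n l' -> h l * (expR (2^-1 * sqn n l'))%:E = f l.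
  by rewrite /h => ->; rewrite -muleA -EFinM -expRD mulNr addNr expR0 mule1.
have := ge0_integral_gauss_vec_tilt n (-1)%R h N10 mh h0.
rewrite normrN1 expr1n invr1 mul1e.
under eq_integral do rewrite E ?sqn_scale ?sqrrN ?expr1n ?mul1r//.
by under [in RHS]eq_integral do rewrite E//.
Qed.

(** In the tilt identity take [h l = e^(-|l|^2 / (2 c^2))]: scaled by [c], it cancels the weight,
    and the left side is the total mass 1. *)
Lemma integral_gauss_vec_expR_sqn n (c : R) : (0 < c)%R ->
  \int[P n]_t (expR (2^-1 * (1 - (c ^+ 2)^-1) * sqn n t))%:E = (c ^+ n)%:E.
Proof.
move=> c0.
pose h l : \bar R := (expR (- (2^-1 * (c ^+ 2)^-1) * sqn n l))%:E.
have mh : measurable_seq n h by exact: measurable_expR_sqn.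
have h0 l : 0 <= h l by rewrite lee_fin expR_ge0.
have cn : (c != 0)%R by rewrite gt_eqF.
have := ge0_integral_gauss_vec_tilt n c h cn mh h0.
rewrite gtr0_norm//.
under eq_integral.
  move=> t _.
  rewrite /h sqn_scale -EFinM -expRD (_ : _ + _ = 0)%R; last by field.
  over.
rewrite expR0 integral_cst//= [X in 1 * X](_ : _ = 1); last exact: probability_setT.
under [in RHS]eq_integral.
  move=> t _.
  rewrite /h -EFinM -expRD -mulrDl (_ : - _ + _ = 2^-1 * (1 - (c ^+ 2)^-1))%R; last by ring.
  over.
set I := \int[_]_t _ => H.
by rewrite -[LHS]mul1e -[1](_ : (c ^+ n)%:E * (c ^+ n)^-1%:E = 1) ?mule1 -?muleA -?H ?mule1//
  -EFinM mulfV// expf_neq0.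
Qed.

Lemma measurable_sqn_ge n (a : R) (c : \bar R) :
  measurable_seq n (fun l => if (a <= sqn n l)%R then c else 0).
Proof.
apply: measurable_fun_ifT => //.
by apply: measurable_fun_ler => //; exact: measurable_sqn.
Qed.

(* Chernoff bound with the optimal exponent eps / (2 (1 + eps)). *)
Lemma gauss_vec_tail_le n (eps : R) : (0 < eps)%R ->
  \int[P n]_t (if (n%:R * (1 + eps) <= sqn n t)%R then 1 else 0) <=
  (expR (- (n%:R * eps) / 2) * Num.sqrt (1 + eps) ^+ n)%:E.
Proof.
move=> e0; have e1 : (0 < 1 + eps)%R by rewrite addr_gt0.
pose c := Num.sqrt (1 + eps).
have c0 : (0 < c)%R by rewrite sqrtr_gt0.
pose k := (2^-1 * (1 - (c ^+ 2)^-1))%R.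
have kE : (k = eps / (2 * (1 + eps)))%R.
  by rewrite /k sqr_sqrtr ?(ltW e1)//; field; rewrite gt_eqF.
have k0 : (0 <= k)%R by rewrite kE divr_ge0// ?(ltW e0)// mulr_ge0// ltW.
rewrite EFinM -(integral_gauss_vec_expR_sqn n c c0) -/k.
have mexp := measurable_expR_sqn n k.
rewrite -ge0_integralZl//.
apply: ge0_le_integral => //.
- by move=> t _; case: ifP.
- exact: measurable_sqn_ge.
- by apply: emeasurable_funM.
- move=> t _; rewrite -EFinM -expRD; case: ifPn => H; last by rewrite lee_fin expR_ge0.
  rewrite lee_fin -[leLHS]expR0 ler_expR.
  have -> : (- (n%:R * eps) / 2 + k * sqn n t = k * (sqn n t - n%:R * (1 + eps)))%R.
    by rewrite kE; field; rewrite gt_eqF.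
  by rewrite mulr_ge0// subr_ge0.
Qed.

(** Up to the factor [(2 pi)^(-n/2)], the volume of the ball of radius [r]. *)
Definition ball_weight n (r : R) : \bar R :=
  \int[P n]_t (if (Num.sqrt (sqn n t) <= r)%R then (expR (2^-1 * sqn n t))%:E else 0).

Lemma measurable_sqrt_sqn n : measurable_fun setT (fun t : n.-tuple R => Num.sqrt (sqn n t)).
Proof.
apply: (@measurableT_comp _ _ _ _ _ _ (@Num.sqrt R)); last exact: measurable_sqn.
by apply: continuous_measurable_fun; exact: sqrt_continuous.
Qed.

Lemma measurable_ball_weight n (r : R) (c : \bar R) (h : seq R -> \bar R) : measurable_seq n h ->
  measurable_seq n (fun l => if (Num.sqrt (sqn n l) <= r)%R then h l else c).
Proof.
move=> mh; apply: measurable_fun_ifT => //.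
by apply: measurable_fun_ler => //; exact: measurable_sqrt_sqn.
Qed.

Lemma measurable_ball_expR n (r : R) : measurable_fun setT (fun t : n.-tuple R =>
  if (Num.sqrt (sqn n t) <= r)%R then (expR (2^-1 * sqn n t))%:E else 0).
Proof. exact: (measurable_ball_weight n r 0 _ (measurable_expR_sqn n 2^-1)). Qed.

Lemma ball_weight_ge0 n r : 0 <= ball_weight n r.
Proof. by apply: integral_ge0 => t _; case: ifP => // _; rewrite lee_fin expR_ge0. Qed.

Lemma ball_weight_scale n (r : R) : (0 < r)%R ->
  ball_weight n r = (r ^+ n)%:E * ball_weight n 1.
Proof.
move=> r0.
pose h (l : seq R) : \bar R := if (Num.sqrt (sqn n l) <= 1)%R then 1 else 0.
have mh : measurable_seq n h by apply: measurable_ball_weight; exact: measurable_cst.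
have h0 l : 0 <= h l by rewrite /h; case: ifP.
have rn : (r^-1 != 0)%R by rewrite invr_eq0 gt_eqF.
have ri : (0 <= r^-1)%R by rewrite invr_ge0 ltW.
have := ge0_integral_gauss_vec_tilt n r^-1%R h rn mh h0.
rewrite ger0_norm// exprVn invrK => H.
rewrite /ball_weight.
transitivity (\int[P n]_t (h (map ( *%R r^-1%R) t) * (expR (2^-1 * sqn n t))%:E)).
  apply: eq_integral => t _; rewrite /h sqn_scale sqrtrM ?sqr_ge0// sqrtr_sqr ger0_norm//.
  by rewrite [(r^-1 * _)%R]mulrC ler_pdivrMr// mul1r; case: ifP => _; rewrite ?mul1e ?mul0e.
rewrite H; congr (_ * _); apply: eq_integral => t _; rewrite /h.
by case: ifP => _; rewrite ?mul1e ?mul0e.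
Qed.

Lemma expR_sqn_sqrt n l : (expR (2^-1 * sqn n l) * expR (- Num.sqrt (sqn n l) ^+ 2 / 2) = 1 :> R)%R.
Proof.
rewrite -expRD sqr_sqrtr ?sqn_ge0//.
by rewrite (_ : _ + _ = 0)%R ?expR0//; field.
Qed.

(** Layer cake for the weight [e^(|t|^2/2)]: multiplied by [e^(-|t|^2/2)] it has integral 1, and its
    part in the ball of radius [r] is [k r^n]. The order [n + 1] includes the factor [r] of
    [gauss_weight]. *)
Lemma ball_weight_moment n : ball_weight n 1 * gauss_moment n.+1 = 1.
Proof.
have mexp := measurable_expR_sqn n (2^-1 : R).
have := gauss_layer_cake _ _ (P n) (fun t : n.-tuple R => Num.sqrt (sqn n t))
  (fun t : n.-tuple R => (expR (2^-1 * sqn n t))%:E) (measurable_sqrt_sqn n)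
  (fun=> sqrtr_ge0 _) mexp (fun=> expR_ge0 _).
under eq_integral do rewrite -EFinM expR_sqn_sqrt.
rewrite integral_cst//= [X in 1 * X](_ : _ = 1); last exact: probability_setT.
rewrite mul1e => ->.
rewrite /gauss_moment -ge0_integralZl//; first last.
- exact: ball_weight_ge0.
- by move=> r; rewrite /= in_itv/= andbT => r0; rewrite lee_fin mulr_ge0 ?exprn_ge0 ?expR_ge0.
- apply/measurable_EFinP; apply: measurable_funTS; apply: measurable_funM => //.
  exact: measurable_gauss_half.
rewrite integral_mkcond; apply: eq_integral => r _.
rewrite patchE mem_setE in_itv/= andbT -/(ball_weight n r).
have [r0|r0|<-] := ltgtP 0%R r.
- rewrite (ball_weight_scale n r)// /gauss_weight max_r ?(ltW r0)// exprS !EFinM.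
  by rewrite [LHS]muleC [RHS]muleA; congr (_ * _); rewrite muleAC.
- by rewrite /gauss_weight max_l ?(ltW r0)// mul0r mul0e.
- by rewrite /gauss_weight maxxx mul0r mul0e expr0n/= mul0r mule0.
Qed.

Lemma cvg_sqr_gauss_half : (x ^+ 2 * expR (- x ^+ 2 / 2) @[x --> +oo] --> (0 : R))%R.
Proof.
apply: (@squeeze_cvgr _ _ _ _ (cst 0%R) (fun x : R => 4 * expR (- (x ^+ 2 / 4)))%R).
- near=> x; rewrite mulr_ge0 ?sqr_ge0 ?expR_ge0//=.
  (* Half of the exponential absorbs the polynomial: [v <= e^v] at [v = x^2/4]. *)
  have -> : (- x ^+ 2 / 2 = - (x ^+ 2 / 4) + - (x ^+ 2 / 4))%R by field.
  rewrite expRD mulrA ler_wpM2r ?expR_ge0// expRN ler_pdivrMr ?expR_gt0//.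
  have := expR_ge1Dx (x ^+ 2 / 4); lra.
- exact: cvg_cst.
- rewrite -(mulr0 (4 : R)%R); apply: cvgM; first exact: cvg_cst.
  apply: (cvg_comp (fun x => x ^+ 2 / 4)%R (fun x => expR (- x))%R); last exact: cvgr_expR.
  by apply: gt0_cvgMly => //; exact: cvgr_expr2.
Unshelve. all: by end_near. Qed.

(** Layer cake over the region [|t| >= r0], where [r0^2 = n (1 + eps)]. The shell [r0 <= |t| <= r]
    has weight at least [w (r^n - r0^n)]; the tangent bound and [w >= 1 / B] leave an explicit
    integral. The factor [1 + eps] on the right completes the power [sqrt (1 + eps)^(n-2)], coming
    from [r0^(n-2)], to the power [n]. *)
Lemma gauss_vec_tail_ge n (eps : R) : (2 <= n)%N -> (0 < eps)%R ->
  (2^-1 * (expR (- (n%:R * eps) / 2) * Num.sqrt (1 + eps) ^+ n) / Num.sqrt n%:R)%:E <=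
  (1 + eps)%:E * \int[P n]_t (if (n%:R * (1 + eps) <= sqn n t)%R then 1 else 0).
Proof.
move=> n2 e0; have e1 : (0 < 1 + eps)%R by rewrite addr_gt0.
have nr0 : (0 < n%:R :> R)%R by rewrite ltr0n (leq_trans _ n2).
pose c := Num.sqrt (1 + eps); pose s := Num.sqrt (n%:R : R).
have c0 : (0 < c)%R by rewrite sqrtr_gt0.
have s0 : (0 < s)%R by rewrite sqrtr_gt0.
have s2 : (s ^+ 2 = n%:R)%R by rewrite sqr_sqrtr// ltW.
have c2 : (c ^+ 2 = 1 + eps)%R by rewrite sqr_sqrtr// ltW.
pose r0 := (s * c)%R.
have r0p : (0 < r0)%R by rewrite mulr_gt0.
pose B := (2 * s ^+ n.+1 * expR (- (n%:R / 2)))%R.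
have B0 : (0 < B)%R by rewrite !mulr_gt0 ?exprn_gt0 ?expR_gt0.
(* Finite because the weight is at most [e^(1/2)] on the unit ball. *)
have [w wE] : exists w : R, ball_weight n 1 = w%:E.
  exists (fine (ball_weight n 1)); rewrite fineK// ge0_fin_numE ?ball_weight_ge0//.
  apply: (@le_lt_trans _ _ (\int[P n]_t (expR 2^-1)%:E)); last first.
    by rewrite integral_cst//= [X in _ * X](_ : _ = 1) ?mule1 ?ltry//; exact: probability_setT.
  apply: ge0_le_integral => //.
  - by move=> t _; case: ifP => // _; rewrite lee_fin expR_ge0.
  - exact: measurable_ball_expR.
  - move=> t _; case: ifPn => h; rewrite lee_fin ?expR_ge0// ler_expR -[leRHS]mulr1 ler_wpM2l//.
    by rewrite -(sqr_sqrtr (sqn_ge0 n t)) exprn_ile1 ?sqrtr_ge0.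
have w0 : (0 <= w)%R by rewrite -lee_fin -wE ball_weight_ge0.
(* The Stirling-type estimate enters here: [w] times the moment of order [n + 1] is 1, and that
   moment is at most [B]. *)
have wB : (B^-1 <= w)%R.
  have := ball_weight_moment n; rewrite wE => wm.
  have : 1 <= w%:E * B%:E by rewrite -wm lee_wpmul2l ?lee_fin//; exact: gauss_moment_le.
  by rewrite -EFinM lee_fin -ler_pdivrMr// mul1r.
pose g (t : n.-tuple R) := Num.sqrt (sqn n t).
pose h (t : n.-tuple R) : \bar R := if (r0 <= g t)%R then (expR (2^-1 * sqn n t))%:E else 0.
have mg : measurable_fun setT g by exact: measurable_sqrt_sqn.
have mh : measurable_fun setT h.
  by apply: measurable_fun_ifT => //; [exact: measurable_fun_ler|exact: measurable_expR_sqn].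
have h0 t : 0 <= h t by rewrite /h; case: ifP => // _; rewrite lee_fin expR_ge0.
have QE : \int[P n]_t (if (n%:R * (1 + eps) <= sqn n t)%R then 1 else 0) =
    \int[leb]_r ((gauss_weight r)%:E * \int[P n]_t (if (g t <= r)%R then h t else 0)).
  rewrite -(gauss_layer_cake _ _ (P n) g h mg (fun=> sqrtr_ge0 _) mh h0).
  apply: eq_integral => t _; rewrite /h.
  have -> : (r0 <= g t)%R = (n%:R * (1 + eps) <= sqn n t)%R.
    rewrite -s2 -c2 -exprMn -/r0 -[in RHS](sqr_sqrtr (sqn_ge0 n t)).
    by rewrite (ler_pXn2r (n := 2)) ?nnegrE ?sqrtr_ge0 ?(ltW r0p).
  by case: ifP => _; rewrite ?mul0e// -EFinM expR_sqn_sqrt.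
(* The shell and the inner ball share the sphere [|t| = r0], so the pointwise comparison is an
   inequality. *)
have inner r : (r0 <= r)%R -> (w * (r ^+ n - r0 ^+ n))%:E <=
    \int[P n]_t (if (g t <= r)%R then h t else 0).
  move=> rr.
  have rp : (0 < r)%R by rewrite (lt_le_trans r0p).
  have H : ball_weight n r <= \int[P n]_t (if (g t <= r)%R then h t else 0) + ball_weight n r0.
    rewrite -ge0_integralD//; first last.
    - exact: measurable_ball_expR.
    - by move=> t _; case: ifP => // _; rewrite lee_fin expR_ge0.
    - by apply: measurable_fun_ifT => //; exact: measurable_fun_ler.
    - by move=> t _; case: ifP.
    apply: ge0_le_integral => //.
    - by move=> t _; case: ifP => // _; rewrite lee_fin expR_ge0.
    - exact: measurable_ball_expR.
    - apply: emeasurable_funD; first by apply: measurable_fun_ifT => //; exact: measurable_fun_ler.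
      exact: measurable_ball_expR.
    - move=> t _; rewrite /h -/(g t); have [gr|_] := leP (g t) r; last first.
        by rewrite add0e; case: ifP => // _; rewrite lee_fin expR_ge0.
      have [rg|rg] := leP r0 (g t); last by rewrite (ltW rg) add0e.
      by rewrite leeDl//; case: ifP => // _; rewrite lee_fin expR_ge0.
  move: H; rewrite (ball_weight_scale n r rp) (ball_weight_scale n r0 r0p) wE -!EFinM => H.
  by rewrite mulrBr EFinB leeBlDr// [(w * r ^+ n)%R]mulrC [(w * r0 ^+ n)%R]mulrC.
have [k nk] : exists k, n = k.+2 by exists n.-2; rewrite -[LHS](subnK n2) addn2 subn2.
pose K := (w * (n%:R / 2 * r0 ^+ k))%R.
have K0 : (0 <= K)%R by rewrite !mulr_ge0// ?invr_ge0 ?exprn_ge0 ?(ltW r0p) ?(ltW nr0).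
(* An antiderivative of [x (x^2 - r0^2) e^(-x^2/2)]; its value at [r0] is [- 2 e^(-r0^2/2)]. *)
have dF (x : R) : is_derive x (1 : R)%R (fun x : R => - ((x ^+ 2 - r0 ^+ 2 + 2) * expR (- x ^+ 2 / 2)))%R
    (x * expR (- x ^+ 2 / 2) * (x ^+ 2 - r0 ^+ 2))%R.
  apply: is_derive_eq.
  have sc (a v : R) : (a *: (v : R^o) = a * v)%R by [].
  by rewrite !sc; field.
have tail : \int[leb]_(x in `[r0, +oo[) (x * expR (- x ^+ 2 / 2) * (x ^+ 2 - r0 ^+ 2))%:E =
    (2 * expR (- r0 ^+ 2 / 2))%:E.
  rewrite (ge0_integral_FTCy _ _ _ 0%R dF).
  - by congr EFin; ring.
  - move=> x; apply: cvgM.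
      by apply: cvgM; [exact: cvg_id|exact: continuous_gauss_half].
    by apply: cvgB; [exact: exprn_continuous|exact: cvg_cst].
  - move=> x rx; have xp : (0 <= x)%R by rewrite (le_trans (ltW r0p)).
    rewrite !mulr_ge0 ?expR_ge0// subr_ge0 ler_pXn2r ?nnegrE//; exact: ltW.
  - rewrite (_ : 0 = - (0 + (2 - r0 ^+ 2) * 0))%R; last by rewrite mulr0 addr0 oppr0.
    rewrite (_ : (fun x => _) = (fun x => - (x ^+ 2 * expR (- x ^+ 2 / 2) + (2 - r0 ^+ 2) * expR (- x ^+ 2 / 2))))%R; last first.
      by apply/funext => x; ring.
    apply: cvgN; apply: cvgD; first exact: cvg_sqr_gauss_half.
    by apply: cvgM; [exact: cvg_cst|exact: cvg_gauss_half].
have Qge : (K * (2 * expR (- r0 ^+ 2 / 2)))%:E <=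
    \int[P n]_t (if (n%:R * (1 + eps) <= sqn n t)%R then 1 else 0).
  rewrite QE EFinM -tail -ge0_integralZl//; first last.
  - move=> x; rewrite /= in_itv/= andbT => rx.
    have xp : (0 <= x)%R by rewrite (le_trans (ltW r0p)).
    by rewrite lee_fin !mulr_ge0 ?expR_ge0// subr_ge0 ler_pXn2r ?nnegrE// ltW.
  - apply/measurable_EFinP; apply: measurable_funTS; apply: measurable_funM.
      by apply: measurable_funM => //; exact: measurable_gauss_half.
    by apply: measurable_funB => //; exact: measurable_funX.
  have mG : measurable_fun setT (fun p : R * n.-tuple R => if (g p.2 <= p.1)%R then h p.2 else 0).
    apply: measurable_fun_ifT => //; last exact: (measurableT_comp mh).
    by apply: measurable_fun_ler => //; exact: (measurableT_comp mg).
  have G0 p : 0 <= (if (g p.2 <= p.1)%R then h p.2 else 0) by case: ifP.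
  have mI := measurable_fun_fubini_tonelli_F (m2 := P n) _ mG G0.
  have mw : measurable_fun setT (fun r : R => (gauss_weight r)%:E).
    by apply/measurable_EFinP; exact: measurable_gauss_weight.
  rewrite integral_mkcond; apply: ge0_le_integral => //.
  - move=> r _; rewrite patchE mem_setE in_itv/= andbT; case: ifPn => // rr.
    have rp : (0 <= r)%R by rewrite (le_trans (ltW r0p)).
    apply: mule_ge0; rewrite lee_fin// !mulr_ge0 ?expR_ge0// subr_ge0.
    by rewrite ler_pXn2r ?nnegrE// ltW.
  - apply/(measurable_restrictT _ _).1 => //; apply/measurable_EFinP; apply: measurable_funTS.
    apply: measurable_funM => //; apply: measurable_funM.
      by apply: measurable_funM => //; exact: measurable_gauss_half.
    by apply: measurable_funB => //; exact: measurable_funX.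
  - exact: (emeasurable_funM mw mI).
  - move=> r _; rewrite patchE mem_setE in_itv/= andbT; case: ifPn => rr; last first.
      rewrite [leLHS](_ : _ = 0)//.
      by apply: mule_ge0; [rewrite lee_fin gauss_weight_ge0|apply: integral_ge0 => t _; case: ifP].
    have rp : (0 <= r)%R by rewrite (le_trans (ltW r0p)).
    apply: le_trans; last first.
      by apply: lee_wpmul2l; [rewrite lee_fin gauss_weight_ge0|exact: inner].
    rewrite -!EFinM lee_fin /gauss_weight max_r// mulrCA ler_wpM2l ?mulr_ge0 ?expR_ge0//.
    have := convex_pow_le k r r0 r0p rr; rewrite -nk => /(ler_wpM2l w0).
    by rewrite /K !mulrA.
apply: le_trans; last first.
  by apply: lee_wpmul2l; [rewrite lee_fin ltW|exact: Qge].
rewrite -EFinM lee_fin -/c -/s.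
apply: (@le_trans _ _ ((1 + eps) * (B^-1 * (n%:R / 2 * r0 ^+ k) * (2 * expR (- r0 ^+ 2 / 2)))))%R; last first.
  rewrite ler_wpM2l ?(ltW e1)// ler_wpM2r ?mulr_ge0 ?expR_ge0// ler_wpM2r//.
  by rewrite !mulr_ge0 ?invr_ge0 ?exprn_ge0 ?(ltW r0p) ?(ltW nr0).
(* The two sides are equal: the powers of [s] and [c] match, and the factor [e^(-n/2)] of [B]
   cancels. *)
rewrite le_eqVlt; apply/orP; left; apply/eqP.
have -> : (expR (- r0 ^+ 2 / 2) = expR (- (n%:R * eps) / 2) * expR (- (n%:R / 2)))%R.
  by rewrite -expRD exprMn s2 c2; congr expR; field.
rewrite /B /r0 -c2 exprMn.
have E20 : (0 < expR (- (n%:R / 2)) :> R)%R by exact: expR_gt0.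
move: (expR (- (n%:R * eps) / 2))%R => E1.
move: (expR (- (n%:R / 2)))%R E20 => E2 E20.
rewrite -[in RHS]s2 nk !exprS expr0.
field.
by rewrite !gt_eqF ?exprn_gt0.
Qed.

End GaussTail.

(** * The truncated gap for a pair of unit vectors *)

Section Truncated.
Import numFieldNormedType.Exports.
Context {R : realType}.
Local Notation P := (gauss_vec (R := R)).

Definition vec d (l : seq R) : 'cV[R]_d := \col_(i < d) l`_i.

Definition sigma d : R := Num.sqrt (d%:R^-1).

Lemma dotv_vec d (a : 'cV[R]_d) l : dotv a (vec d l) = lin d (fun i => a i 0) l.
Proof. by apply: eq_bigr => i _; rewrite mxE. Qed.

Lemma dotv_vec_vec d l : dotv (vec d l) (vec d l) = sqn d l.
Proof. by apply: eq_bigr => i _; rewrite mxE expr2. Qed.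

Lemma lin_sub d (a b : 'I_d -> R) l : lin d a l - lin d b l = lin d (fun i => a i - b i) l.
Proof. by rewrite /lin -sumrB; apply: eq_bigr => i _; rewrite mulrBl. Qed.

Lemma dotv_sqr d (a : 'cV[R]_d) : dotv a a = \sum_(i < d) a i 0 ^+ 2.
Proof. by apply: eq_bigr => i _; rewrite expr2. Qed.

Lemma dotv_ge0 d (a : 'cV[R]_d) : 0 <= dotv a a.
Proof. by rewrite dotv_sqr; apply: sumr_ge0 => i _; exact: sqr_ge0. Qed.

Lemma dotvDl d (a b c : 'cV[R]_d) : dotv (a + b) c = dotv a c + dotv b c.
Proof. by rewrite /dotv -big_split; apply: eq_bigr => i _; rewrite mxE mulrDl. Qed.

Lemma dotvC d (a b : 'cV[R]_d) : dotv a b = dotv b a.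
Proof. by apply: eq_bigr => i _; rewrite mulrC. Qed.

Lemma dotvDr d (a b c : 'cV[R]_d) : dotv a (b + c) = dotv a b + dotv a c.
Proof. by rewrite dotvC dotvDl !(dotvC d a). Qed.

Lemma dotvZl d k (a b : 'cV[R]_d) : dotv (k *: a) b = k * dotv a b.
Proof. by rewrite /dotv mulr_sumr; apply: eq_bigr => i _; rewrite mxE mulrA. Qed.

Lemma dotvZr d k (a b : 'cV[R]_d) : dotv a (k *: b) = k * dotv a b.
Proof. by rewrite dotvC dotvZl dotvC. Qed.

(** The squared norm of [v] minus its projection on [a] is nonnegative. *)
Lemma dotv_unit_sqr_le d (a v : 'cV[R]_d) : on_sphere a -> dotv a v ^+ 2 <= dotv v v.
Proof.
move=> a1; have := dotv_ge0 d (v + (- dotv a v) *: a).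
rewrite dotvDl !dotvDr !dotvZl !dotvZr a1 (dotvC d v) expr2; lra.
Qed.

(** Parallelogram law: [|a - b|^2 = 4 - |a + b|^2]. *)
Lemma dotv_sub_le4 d (a b : 'cV[R]_d) : on_sphere a -> on_sphere b ->
  dotv (a - b) (a - b) <= 4.
Proof.
move=> a1 b1; have := dotv_ge0 d (a + b).
by rewrite -scaleN1r !dotvDl !dotvDr !dotvZl !dotvZr a1 b1 (dotvC d b); lra.
Qed.

(** As [1 + eps >= 1], a squared norm below [1 + eps] also bounds the norm by [1 + eps], so
    thresholds stay inside [[-s, s]]. *)
Lemma dotv_unit_le d (eps : R) (a v : 'cV[R]_d) : 0 < eps -> on_sphere a ->
  dotv v v < 1 + eps -> `|dotv a v| <= 1 + eps.
Proof.
move=> e0 a1 vs.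
rewrite -(ler_pXn2r (n := 2)) ?nnegrE ?normr_ge0 ?addr_ge0 ?(ltW e0)//.
rewrite real_normK ?num_real//; have := dotv_unit_sqr_le d a v a1; nra.
Qed.

(** What the integral over [tau] leaves of the kernel for one pair [(g, g')], with [a = g^-1 x] and
    [b = g'^-1 z]; the value 0 is the null template. *)
Definition truncated_gap d (eps : R) (a b : 'cV[R]_d) (l : seq R) : \bar R :=
  if dotv (vec d l) (vec d l) < 1 + eps
  then (1 + eps - Num.max (dotv a (vec d l)) (dotv b (vec d l)))%:E else 0%E.

Lemma truncated_gap_ge0 d (eps : R) (a b : 'cV[R]_d) l : 0 < eps ->
  on_sphere a -> on_sphere b -> (0 <= truncated_gap d eps a b l)%E.
Proof.
move=> e0 a1 b1; rewrite /truncated_gap; case: ifPn => // vs.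
rewrite lee_fin subr_ge0 ge_max.
by apply/andP; split; apply: (le_trans (ler_norm _)); exact: dotv_unit_le.
Qed.

Lemma measurable_truncated_gap d (eps : R) (a b : 'cV[R]_d) :
  measurable_seq d (truncated_gap d eps a b).
Proof.
rewrite /measurable_seq /truncated_gap; apply: measurable_fun_ifT => //.
  by apply: measurable_fun_ltr => //; under eq_fun do rewrite dotv_vec_vec; exact: measurable_sqn.
apply/measurable_EFinP; apply: measurable_funB => //.
by apply: measurable_maxr; under eq_fun do rewrite dotv_vec; exact: measurable_lin.
Qed.

Lemma chi_square_tail_le d (eps : R) : 0 < eps < 1 ->
  (\int[P d]_t (if (d%:R * (1 + eps) <= sqn d t)%R then 1 else 0) <=
   (expR (- (d%:R * eps ^+ 2) / 8))%:E)%E.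
Proof.
move=> /andP[e0 e1]; apply: (le_trans (gauss_vec_tail_le d eps e0)).
rewrite lee_fin.
have h : Num.sqrt (1 + eps) ^+ d <= expR (d%:R * ((eps - eps ^+ 2 / 4) / 2)).
  rewrite expRM_natl lerXn2r ?nnegrE ?expR_ge0 ?sqrtr_ge0//.
  rewrite -(ler_pXn2r (n := 2)) ?nnegrE ?expR_ge0 ?sqrtr_ge0// sqr_sqrtr ?addr_ge0 ?(ltW e0)//.
  rewrite -expRM_natl mulrCA mulfV// mulr1.
  by apply: one_plus_le_expR; rewrite !ltW.
apply: (le_trans (ler_wpM2l (expR_ge0 _) h)).
by rewrite -expRD ler_expR; lra.
Qed.

Lemma powR_half_nat (a : R) d : 0 <= a -> a `^ (d%:R / 2) = Num.sqrt a ^+ d.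
Proof.
by move=> a0; rewrite mulrC powRrM powR_mulrn ?powR_ge0// powR12_sqrt.
Qed.

(** The middle term equals [s + Z - s Q], with [Q] the tail probability and [Z] the integral over
    the tail of [sigma |<a - b, t>| / 2]. Here [0 <= Z <= p / sqrt d], and [Q] lies between the two
    tail bounds. The witness [f] records finiteness. *)
Lemma truncated_gap_bounds d (eps : R) (a b : 'cV[R]_d) : (2 <= d)%N -> 0 < eps < 1 ->
  on_sphere a -> on_sphere b -> exists2 f : R,
  (\int[P d]_t truncated_gap d eps a b (map ( *%R (sigma d)) t) = f%:E)%E &
  1 + eps - delta2 d eps <= f + normv (a - b) / Num.sqrt (pi *+ 2 * d%:R) <= 1 + eps + delta1 d eps.
Proof.
move=> d2 he a1 b1; have /andP[e0 e1] := he.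
have s0 : 0 < 1 + eps by rewrite addr_gt0.
have dr0 : 0 < d%:R :> R by rewrite ltr0n (leq_trans _ d2).
have sg0 : 0 < sigma d by rewrite sqrtr_gt0 invr_gt0.
have sg2 : sigma d ^+ 2 = d%:R^-1 by rewrite sqr_sqrtr// invr_ge0 ltW.
have sgE : sigma d = (Num.sqrt d%:R)^-1 by rewrite /sigma sqrtrV// ltW.
pose al l := lin d (fun i => a i 0) l.
pose be l := lin d (fun i => b i 0) l.
pose out (l : seq R) := d%:R * (1 + eps) <= sqn d l.
have inE l : (dotv (vec d (map ( *%R (sigma d)) l)) (vec d (map ( *%R (sigma d)) l)) < 1 + eps) = ~~ out l.
  by rewrite dotv_vec_vec sqn_scale sg2 /out -ltNge mulrC ltr_pdivrMr// mulrC.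
have out_scale l : out (map ( *%R (-1)) l) = out l by rewrite /out sqn_scale sqrrN expr1n mul1r.
have mout : measurable_fun setT (fun t : d.-tuple R => out t).
  by apply: measurable_fun_ler => //; exact: measurable_sqn.
have mal : measurable_fun setT (fun t : d.-tuple R => al t) by exact: measurable_lin.
have mbe : measurable_fun setT (fun t : d.-tuple R => be t) by exact: measurable_lin.
have mab : measurable_fun setT (fun t : d.-tuple R => (sigma d / 2 * `|al t - be t|)%R).
  apply: measurable_funM => //; apply: measurableT_comp; last exact: measurable_funB.
  by apply: continuous_measurable_fun; exact: norm_continuous.
pose gap l : \bar R := truncated_gap d eps a b (map ( *%R (sigma d)) l).
have gap0 l : (0 <= gap l)%E by exact: truncated_gap_ge0.
have mgap : measurable_seq d gap by apply: measurable_seq_map; exact: measurable_truncated_gap.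
have gapE l : gap l = if out l then 0%E else (1 + eps - sigma d * Num.max (al l) (be l))%:E.
  rewrite /gap /truncated_gap inE !dotv_vec !lin_scale -/(al l) -/(be l) -maxr_pMr ?(ltW sg0)//.
  by case: (out l).
(* Average over [t] and [-t]: [max u v + max (-u) (-v) = |u - v|], and the truncation event is
   even. *)
pose sym l : \bar R := if out l then 0%E else (1 + eps - sigma d / 2 * `|al l - be l|)%:E.
have symE l : (2%:E * sym l = gap l + gap (map ( *%R (-1)%R) l))%E.
  rewrite /sym !gapE out_scale; case: (out l); first by rewrite mule0 adde0.
  rewrite -EFinM -EFinD /al /be !lin_scale -/(al l) -/(be l); congr EFin.
  rewrite !mulN1r -oppr_min.
  by rewrite maxr_absE minr_absE; field.
have sym0 l : (0 <= sym l)%E.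
  have : (0 <= 2%:E * sym l)%E by rewrite symE adde_ge0.
  by rewrite pmule_rge0.
have msym : measurable_fun setT (fun t : d.-tuple R => sym t).
  by apply: measurable_fun_ifT => //; apply/measurable_EFinP; exact: measurable_funB.
have gap_sym : (\int[P d]_t gap t = \int[P d]_t sym t)%E.
  have H : (2%:E * \int[P d]_t sym t = 2%:E * \int[P d]_t gap t)%E.
    rewrite -ge0_integralZl//.
    under eq_integral do rewrite symE.
    rewrite ge0_integralD//; last exact: (measurable_seq_map _ _ _ mgap).
    by rewrite ge0_integral_gauss_vec_opp// mule_natl mule2n.
  have := congr1 (fun u => (2^-1%:E * u)%E) H.
  by rewrite !muleA -EFinM mulVf// !mul1e.
pose Q := (\int[P d]_t (if out t then 1 else 0) : \bar R)%E.
pose Z := (\int[P d]_t (if out t then (sigma d / 2 * `|al t - be t|)%:E else 0) : \bar R)%E.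
have mQ : measurable_fun setT (fun t : d.-tuple R => if out t then 1%E else 0%E : \bar R).
  exact: measurable_fun_ifT.
have Q0 : (0 <= Q)%E by apply: integral_ge0 => t _; case: ifP.
have Z0 : (0 <= Z)%E.
  apply: integral_ge0 => t _; case: ifP => // _.
  by rewrite lee_fin mulr_ge0// divr_ge0// ltW.
pose nab := normv (a - b) / Num.sqrt (pi *+ 2 * d%:R).
have nabE : (\int[P d]_t (sigma d / 2 * `|al t - be t|)%:E = nab%:E)%E.
  under eq_integral do rewrite EFinM.
  have h0 : (0 <= (sigma d / 2)%:E)%E by rewrite lee_fin divr_ge0// ltW.
  rewrite ge0_integralZl//; last first.
    apply/measurable_EFinP; apply: measurableT_comp; last exact: measurable_funB.
    by apply: continuous_measurable_fun; exact: norm_continuous.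
  under eq_integral do rewrite /al /be lin_sub.
  rewrite integral_gauss_vec_abs_lin -EFinM; congr EFin.
  have pp : 0 < Num.sqrt (pi *+ 2 : R) by rewrite sqrtr_gt0 pmulrn_lgt0// pi_gt0.
  rewrite /nab /normv dotv_sqr sgE [Num.sqrt (pi *+ 2 * _)]sqrtrM; last first.
    by rewrite mulrn_wge0//; exact: pi_ge0.
  have -> : \sum_(i < d) (a i 0 - b i 0) ^+ 2 = \sum_(i < d) (a - b) i 0 ^+ 2.
    by apply: eq_bigr => i _; rewrite !mxE.
  move: (Num.sqrt (pi *+ 2)) pp => Pi pp.
  by field; rewrite !gt_eqF ?sqrtr_gt0.
(* The integrands agree pointwise, inside and outside the truncation; negative terms are moved
   across because the values are in [\bar R]. *)
have key : (\int[P d]_t gap t + nab%:E + (1 + eps)%:E * Q = (1 + eps)%:E + Z)%E.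
  rewrite gap_sym -nabE -ge0_integralZl ?lee_fin ?(ltW s0)//; last by move=> t _; case: ifP.
  have n0 t : (0 <= (sigma d / 2 * `|al t - be t|)%:E)%E.
    by rewrite lee_fin mulr_ge0// divr_ge0// ltW.
  rewrite -ge0_integralD//; last exact/measurable_EFinP.
  rewrite -ge0_integralD//; first last.
  - by apply: emeasurable_funM.
  - by move=> t _; case: ifP => _; rewrite ?mule0// mule1 lee_fin ltW.
  - by apply: emeasurable_funD => //; exact/measurable_EFinP.
  - by move=> t _; rewrite adde_ge0.
  rewrite [X in (X + Z)%E](_ : _ = \int[P d]_t (1 + eps)%:E)%E; last first.
    by rewrite integral_cst//= [X in (_ * X)%E](_ : _ = 1%E) ?mule1//; exact: probability_setT.
  rewrite -ge0_integralD//; first last.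
  - by apply: measurable_fun_ifT => //; exact/measurable_EFinP.
  - by move=> t _; case: ifP.
  - by move=> t _; rewrite lee_fin ltW.
  apply: eq_integral => t _; rewrite /sym; case: (out t).
    by rewrite add0e mule1 addeC.
  by rewrite mule0 !adde0 -EFinD subrK.
(* The square root of the tail bound; it also balances the weighted AM-GM inequality below. *)
pose p := expR (- (d%:R * eps ^+ 2) / 16).
have p0 : 0 < p by exact: expR_gt0.
have p2 : expR (- (d%:R * eps ^+ 2) / 8) = p ^+ 2 by rewrite /p -expRM_natl; congr expR; field.
have Qle : (Q <= (p ^+ 2)%:E)%E by rewrite -p2; exact: chi_square_tail_le.
have [q Qq] : exists q, Q = q%:E.
  by exists (fine Q); rewrite fineK// ge0_fin_numE// (le_lt_trans Qle)// ltry.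
have c1 : 0 <= sigma d * p / 8 by rewrite divr_ge0// mulr_ge0// ?(ltW sg0) ?(ltW p0).
have c2 : 0 <= sigma d / (2 * p) by rewrite divr_ge0// ?mulr_ge0// ?(ltW sg0) ?(ltW p0).
have Zle : (Z <= (sigma d * p)%:E)%E.
  have my2 : measurable_fun setT (fun t : d.-tuple R => ((al t - be t) ^+ 2)%:E).
    by apply/measurable_EFinP; apply: measurable_funX; exact: measurable_funB.
  (* Cauchy-Schwarz in pointwise form: [y / 2 <= p y^2 / 8 + 1 / (2 p)]. With [E y^2 <= 4] and tail
     probability at most [p^2], each term contributes at most [sigma p / 2]. *)
  apply: (@le_trans _ _ (\int[P d]_t ((sigma d * p / 8)%:E * ((al t - be t) ^+ 2)%:E +
      (sigma d / (2 * p))%:E * (if out t then 1 else 0)))%E).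
    apply: ge0_le_integral => //.
    - by move=> t _; case: ifP => // _; rewrite lee_fin mulr_ge0// divr_ge0// ltW.
    - by apply: measurable_fun_ifT => //; exact/measurable_EFinP.
    - by apply: emeasurable_funD; exact: emeasurable_funM.
    - move=> t _; case: (out t); last first.
        by rewrite mule0 adde0 -EFinM lee_fin mulr_ge0// sqr_ge0.
      rewrite mule1 -EFinM -EFinD lee_fin -[in leRHS](real_normK (num_real (al t - be t))).
      set y := `|_|; rewrite -subr_ge0.
      have -> : sigma d * p / 8 * y ^+ 2 + sigma d / (2 * p) - sigma d / 2 * y =
        sigma d / (8 * p) * (p * y - 2) ^+ 2 by field; rewrite gt_eqF.
      by rewrite mulr_ge0 ?sqr_ge0// divr_ge0// ?mulr_ge0// ?(ltW sg0) ?(ltW p0).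
  rewrite ge0_integralD//; first last.
  - exact: emeasurable_funM.
  - by move=> t _; case: ifP => _; rewrite ?mule0// mule1 lee_fin.
  - exact: emeasurable_funM.
  - by move=> t _; rewrite -EFinM lee_fin mulr_ge0// sqr_ge0.
  rewrite ge0_integralZl//; last by move=> t _; rewrite lee_fin sqr_ge0.
  rewrite ge0_integralZl//; last by move=> t _; case: ifP.
  rewrite -/Q Qq.
  under eq_integral do rewrite /al /be lin_sub.
  rewrite integral_gauss_vec_sqr_lin -!EFinM -EFinD lee_fin.
  have -> : \sum_(i < d) (a i 0 - b i 0) ^+ 2 = dotv (a - b) (a - b).
    by rewrite dotv_sqr; apply: eq_bigr => i _; rewrite !mxE.
  have h4 := dotv_sub_le4 d a b a1 b1.
  have qp : q <= p ^+ 2 by rewrite -lee_fin -Qq.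
  have pE : sigma d * p / 8 * 4 + sigma d / (2 * p) * p ^+ 2 = sigma d * p.
    by field; rewrite gt_eqF.
  by rewrite -[leRHS]pE; apply: lerD; apply: ler_wpM2l.
have [z Zz] : exists z, Z = z%:E.
  by exists (fine Z); rewrite fineK// ge0_fin_numE// (le_lt_trans Zle)// ltry.
have F0 : (0 <= \int[P d]_t gap t)%E by apply: integral_ge0.
have [f Ff] : exists f, (\int[P d]_t gap t = f%:E)%E.
  exists (fine (\int[P d]_t gap t)%E); rewrite fineK// ge0_fin_numE//.
  apply: (@le_lt_trans _ _ ((1 + eps)%:E + Z)%E); last by rewrite Zz -EFinD ltry.
  rewrite -key -addeA leeDl// adde_ge0 ?mule_ge0 ?lee_fin ?(ltW s0)//.
  by rewrite divr_ge0 ?sqrtr_ge0.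
exists f => //; rewrite -/nab.
have {}key : f + nab + (1 + eps) * q = 1 + eps + z.
  apply: EFin_inj.
  change (f%:E + nab%:E + (1 + eps)%:E * q%:E = (1 + eps)%:E + z%:E)%E.
  by rewrite -Qq -Zz -Ff.
have Zz0 : 0 <= z by rewrite -lee_fin -Zz.
have zle : z <= sigma d * p by rewrite -lee_fin -Zz.
have qle : q <= p ^+ 2 by rewrite -lee_fin -Qq.
have := gauss_vec_tail_ge d eps d2 e0; rewrite -/Q Qq -EFinM lee_fin => qge.
rewrite /delta1 /delta2 p2 -/p powR_half_nat ?(ltW s0)//.
rewrite sgE mulrC in zle.
have -> : - (eps * d%:R) / 2 = - (d%:R * eps) / 2 :> R by rewrite (mulrC eps).
have := ler_wpM2l (ltW s0) qle.
have : 0 <= p / Num.sqrt d%:R by rewrite divr_ge0// ltW.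
by move: (p / Num.sqrt d%:R) zle qge => Y; lra.
Qed.

End Truncated.

(** * Averaging over the group *)

Section Action.
Import numFieldNormedType.Exports.
Context {R : realType} (d : nat) (dG : measure_display) (G : measurableType dG)
  (mu : probability G R) (mulg : G -> G -> G) (invg : G -> G) (oneg : G)
  (rho : G -> 'M[R]_d).
Context (Hact : orth_haar_action mu mulg invg oneg rho).
Local Notation P := (gauss_vec (R := R)).
Local Notation leb := (@lebesgue_measure R).

Let mulVg a : mulg (invg a) a = oneg. Proof. by case: Hact => _ [_ [/(_ a)[]]]. Qed.
Let mulgV a : mulg a (invg a) = oneg. Proof. by case: Hact => _ [_ [/(_ a)[]]]. Qed.
Let rho1 : rho oneg = 1%:M. Proof. by case: Hact => _ [_ [_ [[]]]]. Qed.
Let rhoM a b : rho (mulg a b) = rho a *m rho b. Proof. by case: Hact => _ [_ [_ [[_ /(_ a b)]]]]. Qed.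
Let rho_orth a : (rho a)^T *m rho a = 1%:M. Proof. by case: Hact => _ [_ [_ [_ [/(_ a)]]]]. Qed.
Let measurable_rho i j : measurable_fun setT (fun g => rho g i j).
Proof. by case: Hact => _ [_ [_ [_ [_ [/(_ i j)]]]]]. Qed.
Let measurable_mull a : measurable_fun setT (mulg a).
Proof. by case: Hact => _ [_ [_ [_ [_ [_ [/(_ a)[]]]]]]]. Qed.
Let measurable_mulr a : measurable_fun setT (fun g => mulg g a).
Proof. by case: Hact => _ [_ [_ [_ [_ [_ [/(_ a)[]]]]]]]. Qed.
Let haarl a A : measurable A -> mu ((mulg a) @^-1` A) = mu A.
Proof. by case: Hact => _ [_ [_ [_ [_ [_ [_ /(_ a A) H]]]]]] /H[]. Qed.
Let haarr a A : measurable A -> mu ((fun g => mulg g a) @^-1` A) = mu A.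
Proof. by case: Hact => _ [_ [_ [_ [_ [_ [_ /(_ a A) H]]]]]] /H[]. Qed.

(** * Haar integrals, orthogonality and measurability along the action *)

Lemma ge0_integral_mull a (f : G -> \bar R) : measurable_fun setT f ->
  (forall g, 0 <= f g)%E -> (\int[mu]_g f (mulg a g) = \int[mu]_g f g)%E.
Proof.
move=> mf f0.
rewrite [RHS](eq_measure_integral (pushforward mu (mulg a))) => [|A mA _]; last first.
  by rewrite /= /pushforward haarl.
by rewrite ge0_integral_pushforward.
Qed.

Lemma ge0_integral_mulr a (f : G -> \bar R) : measurable_fun setT f ->
  (forall g, 0 <= f g)%E -> (\int[mu]_g f (mulg g a) = \int[mu]_g f g)%E.
Proof.
move=> mf f0.
rewrite [RHS](eq_measure_integral (pushforward mu (fun g => mulg g a))) => [|A mA _]; last first.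
  by rewrite /= /pushforward haarr.
by rewrite ge0_integral_pushforward//; exact: measurable_mulr.
Qed.

Lemma rho_inv a : rho (invg a) = (rho a)^T.
Proof.
have H : rho (invg a) *m rho a = 1%:M by rewrite -rhoM mulVg.
by rewrite -[LHS]mulmx1 -(mulmx1C (rho_orth a)) mulmxA H mul1mx.
Qed.

Lemma dotv_mulmx (A : 'M[R]_d) (x y : 'cV[R]_d) : dotv x (A *m y) = dotv (A^T *m x) y.
Proof.
rewrite /dotv; under eq_bigr do rewrite mxE mulr_sumr.
under [RHS]eq_bigr do rewrite mxE mulr_suml.
rewrite exchange_big /=; apply: eq_bigr => i _; apply: eq_bigr => j _.
by rewrite mxE; ring.
Qed.

Lemma dotv_rho g (x y : 'cV[R]_d) : dotv (rho g *m x) (rho g *m y) = dotv x y.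
Proof. by rewrite dotv_mulmx mulmxA rho_orth mul1mx. Qed.

Lemma normv_rho g (x : 'cV[R]_d) : normv (rho g *m x) = normv x.
Proof. by rewrite /normv dotv_rho. Qed.

Lemma on_sphere_rhoT g (x : 'cV[R]_d) : on_sphere x -> on_sphere ((rho g)^T *m x).
Proof. by rewrite /on_sphere -rho_inv dotv_rho. Qed.

Lemma measurable_mulmx_rho d' (W : measurableType d') (u : W -> G) (v : W -> 'cV[R]_d) :
  measurable_fun setT u -> (forall i, measurable_fun setT (fun w => v w i 0)) ->
  forall i, measurable_fun setT (fun w => (rho (u w) *m v w) i 0).
Proof.
move=> mu' mv i; under eq_fun do rewrite mxE.
apply: measurable_sum => j; apply: measurable_funM => //.
exact: (measurableT_comp (measurable_rho i j) mu').
Qed.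

Lemma measurable_dotv d' (W : measurableType d') (u v : W -> 'cV[R]_d) :
  (forall i, measurable_fun setT (fun w => u w i 0)) ->
  (forall i, measurable_fun setT (fun w => v w i 0)) ->
  measurable_fun setT (fun w => dotv (u w) (v w)).
Proof. by move=> mu' mv; apply: measurable_sum => j; exact: measurable_funM. Qed.

Lemma measurable_normv d' (W : measurableType d') (u : W -> 'cV[R]_d) :
  (forall i, measurable_fun setT (fun w => u w i 0)) ->
  measurable_fun setT (fun w => normv (u w)).
Proof.
move=> mu'; apply: (@measurableT_comp _ _ _ _ _ _ (@Num.sqrt R)); last exact: measurable_dotv.
by apply: continuous_measurable_fun; exact: sqrt_continuous.
Qed.

Lemma measurable_subv d' (W : measurableType d') (u v : W -> 'cV[R]_d) :
  (forall i, measurable_fun setT (fun w => u w i 0)) ->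
  (forall i, measurable_fun setT (fun w => v w i 0)) ->
  forall i, measurable_fun setT (fun w => (u w - v w) i 0).
Proof. by move=> mu' mv i; under eq_fun do rewrite !mxE; exact: measurable_funB. Qed.

Lemma measurable_vec d' (W : measurableType d') (t : W -> d.-tuple R) :
  measurable_fun setT t -> forall i, measurable_fun setT (fun w => vec d (t w) i 0).
Proof.
move=> mt i; under eq_fun do rewrite mxE.
exact: (measurableT_comp (measurable_nth d i) mt).
Qed.

Lemma measurable_psi_set x t tau : measurable [set g | dotv x (rho g *m t) <= tau].
Proof.
rewrite (_ : [set _ | _] = (fun g => dotv x (rho g *m t)) @^-1` `]-oo, tau]); last first.
  by apply/seteqP; split => g /=; rewrite in_itv.
rewrite -[X in measurable X]setTI.
apply: (measurable_dotv _ _ (fun=> x) (fun g => rho g *m t)) => //.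
exact: (measurable_mulmx_rho _ _ id (fun=> t)).
Qed.

(** Turns a real-valued probability into an integral, so that Tonelli handles products of [psi]. *)
Lemma psiE x t tau :
  ((psi mu rho x t tau)%:E = \int[mu]_g (if (dotv x (rho g *m t) <= tau)%R then 1 else 0))%E.
Proof.
have mS := measurable_psi_set x t tau.
rewrite /psi fineK; last exact: fin_num_measure.
rewrite -[in LHS](setIT [set g | _]) -integral_indic//.
apply: eq_integral => g _; rewrite indicE; case: ifPn => h.
  by rewrite mem_set.
by rewrite memNset//; exact/negP.
Qed.

(** Moving [rho a] across the inner product gives [rho (a^-1 g)], and Haar measure is invariant
    under [g -> a^-1 g]. *)
Lemma psi_rho a x t tau : psi mu rho (rho a *m x) t tau = psi mu rho x t tau.
Proof.
rewrite /psi; congr fine.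
rewrite -[RHS](haarl (invg a)); last exact: measurable_psi_set.
have E g : dotv x (rho (mulg (invg a) g) *m t) = dotv (rho a *m x) (rho g *m t).
  by rewrite rhoM rho_inv -mulmxA dotv_mulmx trmxK.
by congr (mu _); apply/seteqP; split => g /=; rewrite E.
Qed.

Lemma Ks_sym eps x z : Ks mu rho eps x z = Ks mu rho eps z x.
Proof.
rewrite /Ks; congr (fine (gauss_expect _)); apply/funext => v.
by case: ifP => // _; apply: eq_integral => tau _; rewrite mulrC.
Qed.

Lemma Ks_rho eps a b x z : Ks mu rho eps (rho a *m x) (rho b *m z) = Ks mu rho eps x z.
Proof.
rewrite /Ks; congr (fine (gauss_expect _)); apply/funext => v.
by case: ifP => // _; apply: eq_integral => tau _; rewrite !psi_rho.
Qed.

Lemma integral_threshold (s M : R) : `|M| <= s ->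
  (\int[leb]_(tau in `[(- s)%R, s]) (if (M <= tau)%R then 1 else 0) = (s - M)%:E)%E.
Proof.
rewrite ler_norml => /andP[sM Ms].
transitivity (\int[leb]_(tau in `[M, s]) (1 : \bar R))%E.
  rewrite integral_mkcond [RHS]integral_mkcond; apply: eq_integral => tau _.
  rewrite !patchE !mem_setE !in_itv/=.
  have [Mt|] := leP M tau; last by case: ifP.
  by rewrite (le_trans sM).
rewrite integral_cst//= mul1e lebesgue_measure_itv/= lte_fin.
move: Ms; rewrite le_eqVlt => /predU1P[->|->]; last by rewrite EFinB.
by rewrite ltxx subrr.
Qed.

(* [psi x t tau * psi z t tau] is the probability that [<x, g t>] and [<z, g' t>]
   are both at most [tau], for independent [g] and [g']. *)
Lemma integral_psi_psi (s : R) x z t :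
  (forall g, `|dotv x (rho g *m t)| <= s) -> (forall g, `|dotv z (rho g *m t)| <= s) ->
  (\int[leb]_(tau in `[(- s)%R, s]) (psi mu rho x t tau * psi mu rho z t tau)%R%:E =
   \int[mu]_g \int[mu]_g' (s - Num.max (dotv x (rho g *m t)) (dotv z (rho g' *m t)))%R%:E)%E.
Proof.
move=> xs zs.
pose X g := dotv x (rho g *m t); pose Z g := dotv z (rho g *m t).
have mX : measurable_fun setT X.
  apply: (measurable_dotv _ _ (fun=> x) (fun g => rho g *m t)) => //.
  exact: (measurable_mulmx_rho _ _ id (fun=> t)).
have mZ : measurable_fun setT Z.
  apply: (measurable_dotv _ _ (fun=> z) (fun g => rho g *m t)) => //.
  exact: (measurable_mulmx_rho _ _ id (fun=> t)).
pose I (p : R * (G * G)) : \bar R :=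
  if (- s <= p.1 <= s) && (Num.max (X p.2.1) (Z p.2.2) <= p.1) then 1%E else 0%E.
have mI : measurable_fun setT I.
  apply: measurable_fun_ifT => //.
  apply: measurable_and; first apply: measurable_and.
  - exact: measurable_fun_ler.
  - exact: measurable_fun_ler.
  - apply: measurable_fun_ler => //; apply: measurable_maxr.
      by apply: (measurableT_comp mX); exact: measurableT_comp.
    by apply: (measurableT_comp mZ); exact: measurableT_comp.
have I0 p : (0 <= I p)%E by rewrite /I; case: ifP.
have step tau : (\int[mu]_g \int[mu]_g' I (tau, (g, g')) =
    if (- s <= tau <= s)%R then (psi mu rho x t tau * psi mu rho z t tau)%R%:E else 0)%E.
  case: ifP => ts; last first.
    by rewrite integral0_eq// => g _; rewrite integral0_eq// => g' _; rewrite /I /= ts.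
  rewrite EFinM !psiE muleC -ge0_integralZl//; first last.
  - by apply: integral_ge0 => g _; case: ifP.
  - by move=> g _; case: ifP.
  - by apply: measurable_fun_ifT => //; exact: measurable_fun_ler.
  apply: eq_integral => g _; rewrite muleC -ge0_integralZl//; first last.
  - by case: ifP.
  - by move=> g' _; case: ifP.
  - by apply: measurable_fun_ifT => //; exact: measurable_fun_ler.
  apply: eq_integral => g' _; rewrite /I /= ts /= ge_max /X /Z.
  by case: (_ <= tau); case: (_ <= tau); rewrite ?mule0 ?mul0e ?mule1.
pose Q : probability (G * G)%type R := (mu \x mu)%E.
transitivity (\int[leb]_tau \int[Q]_p I (tau, p))%E.
  rewrite integral_mkcond; apply: eq_integral => tau _.
  rewrite patchE mem_setE in_itv/= (fubini_tonelli1 (m1 := mu) (m2 := mu) (fun p => I (tau, p)))//.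
    by rewrite step.
  exact: (measurableT_comp mI (pair1_measurable tau)).
rewrite (fubini_tonelli (m1 := leb) (m2 := Q) I)//.
rewrite (fubini_tonelli1 (m1 := mu) (m2 := mu) (fun p => \int[leb]_tau I (tau, p)))%E//; first last.
- by move=> p; exact: integral_ge0.
- exact: (measurable_fun_fubini_tonelli_G (m1 := leb) I).
apply: eq_integral => g _; apply: eq_integral => g' _.
rewrite -integral_threshold; last first.
  by rewrite ler_norml le_max ge_max; have := xs g; have := zs g'; rewrite !ler_norml => /andP[_ ->] /andP[-> ->].
rewrite [RHS]integral_mkcond; apply: eq_integral => tau _.
rewrite patchE mem_setE in_itv/= /I/= /X /Z.
by case: ((- s <= tau) && (tau <= s)).
Qed.

(** * The kernel as an average over templates and pairs of group elements *)

Context (eps : R) (heps : 0 < eps < 1).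

Let eps0 : 0 < eps. Proof. by case/andP: heps. Qed.

Let scaled (t : d.-tuple R) : d.-tuple R := [tuple of map ( *%R (sigma d)) t].

Let measurable_scaled : measurable_fun setT scaled.
Proof. exact: measurable_map. Qed.

Definition orbit_gap (x z : 'cV[R]_d) (w : d.-tuple R * (G * G)) : \bar R :=
  truncated_gap d eps ((rho w.2.1)^T *m x) ((rho w.2.2)^T *m z) w.1.

Lemma measurable_orbit_gap x z : measurable_fun setT (orbit_gap x z).
Proof.
rewrite /orbit_gap /truncated_gap.
have mv i : measurable_fun setT (fun w : d.-tuple R * (G * G) => vec d w.1 i 0).
  exact: measurable_vec.
apply: measurable_fun_ifT => //.
  by apply: measurable_fun_ltr => //; exact: measurable_dotv.
apply/measurable_EFinP; apply: measurable_funB => //.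
under eq_fun do rewrite -!dotv_mulmx.
apply: measurable_maxr; apply: measurable_dotv => //; apply: measurable_mulmx_rho => //.
  exact: measurableT_comp.
exact: measurableT_comp.
Qed.

Lemma orbit_gap_ge0 x z w : on_sphere x -> on_sphere z -> (0 <= orbit_gap x z w)%E.
Proof. by move=> x1 z1; apply: truncated_gap_ge0 => //; exact: on_sphere_rhoT. Qed.

Let Q : probability (G * G)%type R := (mu \x mu)%E.

Lemma Ks_integrandE x z l : on_sphere x -> on_sphere z ->
  ((if (dotv (vec d l) (vec d l) < 1 + eps)%R then
      \int[leb]_(tau in `[(- (1 + eps))%R, (1 + eps)%R])
        (psi mu rho x (vec d l) tau * psi mu rho z (vec d l) tau)%R%:E
    else 0) =
  \int[mu]_g \int[mu]_g' truncated_gap d eps ((rho g)^T *m x) ((rho g')^T *m z) l)%E.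
Proof.
move=> x1 z1; rewrite /truncated_gap; case: ifPn => h; last first.
  by rewrite integral0_eq// => g _; rewrite integral0_eq.
rewrite integral_psi_psi.
- by apply: eq_integral => g _; apply: eq_integral => g' _; rewrite !dotv_mulmx.
- by move=> g; rewrite dotv_mulmx; apply: dotv_unit_le => //; exact: on_sphere_rhoT.
- by move=> g; rewrite dotv_mulmx; apply: dotv_unit_le => //; exact: on_sphere_rhoT.
Qed.

Let integrand x z (l : seq R) : \bar R :=
  (if (dotv (vec d l) (vec d l) < 1 + eps)%R then
      \int[leb]_(tau in `[(- (1 + eps))%R, (1 + eps)%R])
        (psi mu rho x (vec d l) tau * psi mu rho z (vec d l) tau)%R%:E
    else 0)%E.

Let integrandE x z (t : d.-tuple R) : on_sphere x -> on_sphere z ->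
  integrand x z t = (\int[Q]_p orbit_gap x z (t, p))%E.
Proof.
move=> x1 z1; rewrite /integrand Ks_integrandE//.
rewrite (fubini_tonelli1 (m1 := mu) (m2 := mu) (fun p => orbit_gap x z (t, p)))//.
  exact: (measurableT_comp (measurable_orbit_gap x z) (pair1_measurable t)).
by move=> p; exact: orbit_gap_ge0.
Qed.

Let integrand_ge0 x z l : on_sphere x -> on_sphere z -> (0 <= integrand x z l)%E.
Proof.
move=> x1 z1; rewrite /integrand Ks_integrandE//.
apply: integral_ge0 => g _; apply: integral_ge0 => g' _.
by apply: truncated_gap_ge0 => //; exact: on_sphere_rhoT.
Qed.

Let measurable_integrand x z : on_sphere x -> on_sphere z -> measurable_seq d (integrand x z).
Proof.
move=> x1 z1; rewrite /measurable_seq.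
under eq_fun do rewrite integrandE//.
apply: (measurable_fun_fubini_tonelli_F (m2 := Q)); first exact: measurable_orbit_gap.
by move=> w; exact: orbit_gap_ge0.
Qed.

Lemma Ks_gauss_vec x z : (0 < d)%N -> on_sphere x -> on_sphere z ->
  Ks mu rho eps x z = fine (\int[P d]_t integrand x z (scaled t))%E.
Proof.
move=> d0 x1 z1; rewrite /Ks /gauss_expect; congr fine.
rewrite (iter_gaussE (sigma d) d (integrand x z))//.
- by rewrite sqrtr_gt0 invr_gt0 ltr0n.
- exact: measurable_integrand.
- by move=> l; exact: integrand_ge0.
Qed.

(** Tonelli puts the Gaussian integral innermost, so the bounds for a fixed pair of unit vectors can
    be averaged over the group. *)
Lemma Ks_orbit x z : (0 < d)%N -> on_sphere x -> on_sphere z ->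
  Ks mu rho eps x z = fine (\int[Q]_p \int[P d]_t orbit_gap x z (scaled t, p))%E.
Proof.
move=> d0 x1 z1; rewrite Ks_gauss_vec//; congr fine.
under eq_integral do rewrite integrandE//.
rewrite (fubini_tonelli (m1 := P d) (m2 := Q) (fun w => orbit_gap x z (scaled w.1, w.2)))//.
  apply: (measurableT_comp (measurable_orbit_gap x z)).
  by apply: measurable_fun_pair => //; exact: measurableT_comp.
by move=> w; exact: orbit_gap_ge0.
Qed.

Lemma measurable_normv_orbit x z :
  measurable_fun setT (fun p : G * G => (normv (rho p.1 *m x - rho p.2 *m z))%:E).
Proof.
apply/measurable_EFinP; apply: measurable_normv; apply: measurable_subv; exact: measurable_mulmx_rho.
Qed.

Let normv_orbit_ge0 (v : 'cV[R]_d) : (0 <= (normv v)%:E)%E.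
Proof. by rewrite lee_fin sqrtr_ge0. Qed.

Lemma measurable_normv_sub x z :
  measurable_fun setT (fun g : G => (normv (rho g *m x - z))%:E).
Proof.
apply/measurable_EFinP; apply: measurable_normv.
apply: (measurable_subv _ _ (fun g => rho g *m x) (fun=> z)) => //.
exact: (measurable_mulmx_rho _ _ id (fun=> x)).
Qed.

(* Only translation invariance and Tonelli are used: inversion is not assumed measurable. *)
Lemma orbit_distanceE x z :
  (\int[mu]_g \int[mu]_g' (normv (rho g *m x - rho g' *m z))%:E =
   \int[mu]_g \int[mu]_g' (normv ((rho g)^T *m x - (rho g')^T *m z))%:E)%E.
Proof.
transitivity (\int[mu]_g' \int[mu]_g (normv (rho g *m x - z))%:E)%E.
  rewrite (fubini_tonelli (m1 := mu) (m2 := mu) (fun p => (normv (rho p.1 *m x - rho p.2 *m z))%:E)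
    (measurable_normv_orbit x z) (fun=> normv_orbit_ge0 _)).
  apply: eq_integral => g' _.
  rewrite -[RHS](ge0_integral_mull (invg g') _ (measurable_normv_sub x z) (fun=> normv_orbit_ge0 _)).
  apply: eq_integral => g _; rewrite -[in RHS](normv_rho g') mulmxBr rhoM !mulmxA -rhoM.
  by rewrite mulgV rho1 mul1mx.
apply: eq_integral => g _.
rewrite -[LHS](ge0_integral_mulr (invg g) _ (measurable_normv_sub x z) (fun=> normv_orbit_ge0 _)).
apply: eq_integral => g' _; rewrite -[in RHS](normv_rho g') mulmxBr rhoM rho_inv !mulmxA.
by rewrite (mulmx1C (rho_orth g')) mul1mx.
Qed.

(** The bounds on [F p + c N p] hold for every pair [p] of group elements, since orthogonality keeps
    both vectors on the sphere, and they survive averaging. *)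
Lemma Ks_dG_bounds x z : (2 <= d)%N -> on_sphere x -> on_sphere z ->
  eps - delta2 d eps <= Ks mu rho eps x z - (1 - dG_orbit mu rho x z) <= eps + delta1 d eps.
Proof.
move=> d2 x1 z1.
have d0 : (0 < d)%N by rewrite (leq_trans _ d2).
pose c := (Num.sqrt (pi *+ 2 * d%:R : R))^-1.
have c0 : 0 < c by rewrite invr_gt0 sqrtr_gt0 mulr_gt0 ?ltr0n// pmulrn_lgt0// pi_gt0.
pose F p := (\int[P d]_t orbit_gap x z (scaled t, p))%E.
pose N (p : G * G) : \bar R := (normv ((rho p.1)^T *m x - (rho p.2)^T *m z))%:E.
have mF : measurable_fun setT F.
  apply: (measurable_fun_fubini_tonelli_G (m1 := P d) (fun w => orbit_gap x z (scaled w.1, w.2))).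
    apply: (measurableT_comp (measurable_orbit_gap x z)).
    by apply: measurable_fun_pair => //; exact: measurableT_comp.
  by move=> w; exact: orbit_gap_ge0.
have F0 p : (0 <= F p)%E by apply: integral_ge0 => t _; exact: orbit_gap_ge0.
have mT d' (W : measurableType d') (u : W -> G) (v : 'cV[R]_d) i : measurable_fun setT u ->
    measurable_fun setT (fun w => ((rho (u w))^T *m v) i 0).
  move=> mu'; under eq_fun do rewrite mxE; apply: measurable_sum => j; apply: measurable_funM => //.
  by under eq_fun do rewrite mxE; exact: (measurableT_comp (measurable_rho j i) mu').
have mN : measurable_fun setT N.
  apply/measurable_EFinP; apply: measurable_normv.
  by apply: measurable_subv => i; exact: mT.
have N0 p : (0 <= N p)%E by exact: normv_orbit_ge0.
have bounds p : ((1 + eps - delta2 d eps)%:E <= F p + c%:E * N p <= (1 + eps + delta1 d eps)%:E)%E.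
  have [f fE /andP[lo hi]] := truncated_gap_bounds d eps _ _ d2 heps
    (on_sphere_rhoT p.1 x x1) (on_sphere_rhoT p.2 z z1).
  by rewrite /F /orbit_gap fE /N -EFinM -EFinD !lee_fin mulrC lo hi.
have sumE : (\int[Q]_p (F p + c%:E * N p) = \int[Q]_p F p + c%:E * \int[Q]_p N p)%E.
  rewrite ge0_integralD//.
  - by rewrite ge0_integralZl// lee_fin ltW.
  - by move=> p _; rewrite mule_ge0// lee_fin ltW.
  - exact: emeasurable_funM.
have mS : measurable_fun setT (fun p => F p + c%:E * N p)%E.
  by apply: emeasurable_funD => //; exact: emeasurable_funM.
have S0 p : (0 <= F p + c%:E * N p)%E by rewrite adde_ge0// mule_ge0// lee_fin ltW.
have hiS : (\int[Q]_p (F p + c%:E * N p) <= (1 + eps + delta1 d eps)%:E)%E.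
  rewrite [leRHS](_ : _ = \int[Q]_p (1 + eps + delta1 d eps)%:E)%E; last first.
    by rewrite integral_cst//= [X in (_ * X)%E](_ : _ = 1%E) ?mule1//; exact: probability_setT.
  apply: ge0_le_integral => //; last by move=> p _; case/andP: (bounds p).
have loS : ((1 + eps - delta2 d eps)%:E <= \int[Q]_p (F p + c%:E * N p))%E.
  (* The constant may be negative, where monotonicity for nonnegative integrands does not apply; the
     integral is then above it by sign. *)
  have [lo0|/ltW lo0] := leP 0 (1 + eps - delta2 d eps); last first.
    by apply: (@le_trans _ _ 0%E); [rewrite lee_fin|exact: integral_ge0].
  rewrite [leLHS](_ : _ = \int[Q]_p (1 + eps - delta2 d eps)%:E)%E; last first.
    by rewrite integral_cst//= [X in (_ * X)%E](_ : _ = 1%E) ?mule1//; exact: probability_setT.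
  apply: ge0_le_integral => //.
  by move=> p _; case/andP: (bounds p).
have IF0 : (0 <= \int[Q]_p F p)%E by exact: integral_ge0.
have IN0 : (0 <= \int[Q]_p N p)%E by exact: integral_ge0.
have dGE : dG_orbit mu rho x z = fine (\int[Q]_p N p)%E * c.
  rewrite /dG_orbit orbit_distanceE; congr (fine _ * _).
  by rewrite (fubini_tonelli1 (m1 := mu) (m2 := mu) N).
have KE : Ks mu rho eps x z = fine (\int[Q]_p F p)%E by rewrite Ks_orbit.
rewrite sumE in hiS loS.
(* Both finiteness facts come from the upper bound on the sum of two nonnegative integrals. *)
have IFfin : (\int[Q]_p F p)%E \is a fin_num.
  rewrite ge0_fin_numE//; apply: le_lt_trans (ltry (1 + eps + delta1 d eps)).
  by apply: le_trans hiS; rewrite leeDl// mule_ge0// lee_fin ltW.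
have INfin : (\int[Q]_p N p)%E \is a fin_num.
  rewrite ge0_fin_numE//; apply: (@le_lt_trans _ _ (c^-1%:E * (1 + eps + delta1 d eps)%:E)%E).
    rewrite -[leLHS]mul1e -[1%E](_ : (c^-1%:E * c%:E = 1)%E); last first.
      by rewrite -EFinM mulVf// gt_eqF.
    rewrite -muleA lee_wpmul2l ?lee_fin ?invr_ge0 ?(ltW c0)//.
    by apply: le_trans hiS; rewrite leeDr.
  by rewrite -EFinM ltry.
rewrite dGE KE.
move: hiS loS; rewrite -(fineK IFfin) -(fineK INfin) -EFinM -EFinD !lee_fin /=.
by rewrite [c * _]mulrC; move: (fine _ * c) => A; move: (fine _) => B hi lo; apply/andP; split; lra.
Qed.

(** * Positive semi-definiteness *)

Lemma psi_ge0 x t tau : 0 <= psi mu rho x t tau.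
Proof. exact: fine_ge0. Qed.

Lemma psi_le1 x t tau : psi mu rho x t tau <= 1.
Proof.
have mS := measurable_psi_set x t tau.
by rewrite -lee_fin /psi fineK ?probability_le1//; exact: fin_num_measure.
Qed.

Lemma measurable_psi x :
  measurable_fun setT (fun w : d.-tuple R * R => psi mu rho x (vec d w.1) w.2).
Proof.
apply/measurable_EFinP.
rewrite [X in measurable_fun _ X](_ : _ = fun w : d.-tuple R * R =>
  \int[mu]_g (if (dotv x (rho g *m vec d w.1) <= w.2)%R then 1%E else 0%E))%E; last first.
  by apply/funext => w; rewrite /= psiE.
apply: (measurable_fun_fubini_tonelli_F (m2 := mu)
  (fun q : (d.-tuple R * R) * G => if (dotv x (rho q.2 *m vec d q.1.1) <= q.1.2)%R then 1%E else 0%E)).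
  apply: measurable_fun_ifT => //; apply: measurable_fun_ler; last exact: measurableT_comp.
  apply: measurable_dotv => //; apply: measurable_mulmx_rho => //.
  by apply: measurable_vec; exact: measurableT_comp.
by move=> q; case: ifP.
Qed.

(** Over the single space of pairs (template, [tau]), the quadratic form is the integral over the
    region [on] of the square of [sum_i c_i ps_i]. The coefficients have arbitrary signs, so
    integrability is required; it follows from [psi <= 1] and the bounded range of [tau]. *)
Lemma Ks_psd n (xs : 'I_n -> 'cV[R]_d) (c : 'I_n -> R) : (0 < d)%N ->
  (forall i, on_sphere (xs i)) ->
  0 <= \sum_(i < n) \sum_(j < n) c i * c j * Ks mu rho eps (xs i) (xs j).
Proof.
move=> d0 xs1.
have s0 : 0 < 1 + eps by rewrite addr_gt0.
pose on (w : d.-tuple R * measurableTypeR R) := (dotv (vec d (scaled w.1)) (vec d (scaled w.1)) < 1 + eps) &&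
  ((- (1 + eps) <= w.2) && (w.2 <= 1 + eps)).
pose ps i (w : d.-tuple R * measurableTypeR R) := psi mu rho (xs i) (vec d (scaled w.1)) w.2.
pose k i j w : R := if on w then ps i w * ps j w else 0.
have mon : measurable_fun setT on.
  apply: measurable_and; last by apply: measurable_and; exact: measurable_fun_ler.
  apply: measurable_fun_ltr => //.
  apply: (measurable_dotv _ _ (fun w : d.-tuple R * measurableTypeR R => vec d (scaled w.1)) (fun w => vec d (scaled w.1)));
  by apply: measurable_vec; exact: measurableT_comp.
have mps i : measurable_fun setT (ps i).
  have mp : measurable_fun setT (fun w : d.-tuple R * measurableTypeR R => (scaled w.1, w.2)).
    by apply: measurable_fun_pair => //; exact: measurableT_comp.
  exact: (measurableT_comp (measurable_psi (xs i)) mp).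
have mk i j : measurable_fun setT (fun w => (k i j w)%:E).
  by apply/measurable_EFinP; apply: measurable_fun_ifT => //; exact: measurable_funM.
have k0 i j w : (0 <= (k i j w)%:E)%E.
  by rewrite lee_fin /k; case: ifP => // _; rewrite mulr_ge0// psi_ge0.
pose M : {measure set (d.-tuple R * measurableTypeR R)%type -> \bar R} := (P d \x leb)%E.
have KE i j : (Ks mu rho eps (xs i) (xs j) = fine (\int[M]_w (k i j w)%:E)%E).
  rewrite Ks_gauss_vec//; congr fine.
  rewrite [RHS](fubini_tonelli1 (m1 := P d) (m2 := leb) (fun w => (k i j w)%:E) (mk i j) (k0 i j)).
  apply: eq_integral => t _.
  rewrite /integrand /fubini_F /k /on /=; case: ifPn => ht /=; last by rewrite integral0_eq.
  rewrite integral_mkcond; apply: eq_integral => tau _.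
  by rewrite patchE mem_setE in_itv/=; case: ifP.
have kfin i j : (\int[M]_w (k i j w)%:E < +oo)%E.
  (* A dominating indicator, of integral [2 (1 + eps)]. *)
  pose b (w : d.-tuple R * measurableTypeR R) : \bar R := if (- (1 + eps) <= w.2) && (w.2 <= 1 + eps) then 1%E else 0%E.
  have mb : measurable_fun setT b.
    by apply: measurable_fun_ifT => //; apply: measurable_and; exact: measurable_fun_ler.
  have b0 w : (0 <= b w)%E by rewrite /b; case: ifP.
  apply: (@le_lt_trans _ _ (\int[M]_w b w)%E).
    apply: ge0_le_integral; [by []|by move=> w _; exact: k0|exact: mk|exact: mb|].
    move=> w _; rewrite /k /on /b.
    case: (_ && (w.2 <= _)); rewrite ?andbF//= andbT; case: ifP => // _.
    by rewrite lee_fin -[leRHS]mulr1 ler_pM ?psi_ge0 ?psi_le1.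
  rewrite [ltLHS](fubini_tonelli1 (m1 := P d) (m2 := leb) b mb b0).
  rewrite (_ : fubini_F _ _ = cst ((1 + eps) - - (1 + eps))%:E); last first.
    apply/funext => t; rewrite /fubini_F.
    transitivity (\int[leb]_(tau in `[(- (1 + eps))%R, (1 + eps)%R]) (1 : \bar R))%E.
      rewrite [RHS]integral_mkcond; apply: eq_integral => tau _.
      by rewrite patchE mem_setE in_itv/=.
    by rewrite integral_cst//= mul1e lebesgue_measure_itv/= lte_fin gtrN// EFinB.
  by rewrite integral_cst//= [X in (_ * X)%E](_ : _ = 1%E) ?mule1 ?ltry//; exact: probability_setT.
have ik i j : M.-integrable setT (fun w => (k i j w)%:E).
  apply/integrableP; split; first exact: mk.
  rewrite [ltLHS](_ : _ = \int[M]_w (k i j w)%:E)%E; first exact: kfin.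
  by apply: eq_integral => w _; rewrite gee0_abs.
have ih i j : M.-integrable setT (fun w => (c i * c j * k i j w)%:E).
  by under eq_fun do rewrite EFinM; exact: integrableZl.
have hE i j : ((c i * c j * Ks mu rho eps (xs i) (xs j))%:E = \int[M]_w (c i * c j * k i j w)%:E)%E.
  under eq_integral do rewrite EFinM.
  rewrite integralZl// EFinM KE fineK// ge0_fin_numE//.
  exact: integral_ge0.
have ihs i : M.-integrable setT (fun w => \sum_(j < n) (c i * c j * k i j w)%:E)%E.
  exact: integrable_sum.
rewrite -lee_fin -sumEFin.
under eq_bigr do rewrite -sumEFin.
under eq_bigr => i _.
  under eq_bigr do rewrite hE.
  rewrite -integral_sum//.
  over.
rewrite -integral_sum//; apply: integral_ge0 => w _.
under eq_bigr do rewrite sumEFin.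
rewrite sumEFin lee_fin /k; case: (on w); last first.
  by apply: sumr_ge0 => i _; apply: sumr_ge0 => j _; rewrite mulr0.
rewrite (_ : \sum_i _ = (\sum_(i < n) c i * ps i w) ^+ 2) ?sqr_ge0//.
rewrite expr2 mulr_suml; apply: eq_bigr => i _; rewrite mulr_sumr; apply: eq_bigr => j _.
by rewrite mulrACA.
Qed.

End Action.

(** * Vanishing of the error terms *)

Section Limits.
Import numFieldNormedType.Exports.
Context {R : realType}.

Lemma cvg0_le_invsqrt (u : nat -> R) (C : R) : 0 <= C ->
  (forall n, (0 < n)%N -> `|u n| <= C / Num.sqrt n%:R) -> u @ \oo --> 0.
Proof.
move=> C0 h; apply/cvgrPdist_le => e e0.
near=> n.
have n0 : (0 < n)%N by near: n; exact: nbhs_infty_gt.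
have nr : 0 < n%:R :> R by rewrite ltr0n.
rewrite sub0r normrN; apply: (le_trans (h n n0)).
rewrite ler_pdivrMr ?sqrtr_gt0// mulrC -ler_pdivrMr//.
rewrite -[leLHS]ger0_norm ?divr_ge0 ?(ltW e0)// -sqrtr_sqr ler_sqrt//.
near: n; exact: nbhs_infty_ger.
Unshelve. all: by end_near. Qed.

Lemma le_div_sqrt_nat (a : R) n : 0 <= a -> (0 < n)%N -> a / n%:R <= a / Num.sqrt n%:R.
Proof.
move=> a0 n0; have nr : 1 <= n%:R :> R by rewrite ler1n.
have n0r : 0 < n%:R :> R by rewrite ltr0n.
rewrite ler_wpM2l// lef_pV2 ?posrE ?sqrtr_gt0//.
rewrite -[leRHS]ger0_norm ?(ltW n0r)// -sqrtr_sqr ler_sqrt ?exprn_ge0 ?(ltW n0r)//.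
by rewrite expr2 ler_peMr// ltW.
Qed.

Lemma gauss_factor_le (d : nat) (eps : R) : expR (- (d%:R * eps ^+ 2) / 16) <= 1.
Proof.
by rewrite -[leRHS]expR0 ler_expR mulNr oppr_le0 divr_ge0// mulr_ge0 ?ler0n ?sqr_ge0.
Qed.

(** Both terms are [O(1 / sqrt d)]: for the second, [e^(-eps/2) sqrt (1 + eps) <= 1] since
    [1 + eps <= e^eps]. *)
Lemma cvg_delta1 (eps : R) : 0 < eps < 1 -> (fun d => delta1 d eps) @ \oo --> 0.
Proof.
move=> /andP[e0 e1]; apply: (cvg0_le_invsqrt _ 2) => // n n0.
have s0 : 0 < Num.sqrt n%:R :> R by rewrite sqrtr_gt0 ltr0n.
rewrite /delta1 powR_half_nat ?addr_ge0 ?(ltW e0)//.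
rewrite -mulrBl normrM [`|(Num.sqrt _)^-1|]ger0_norm ?invr_ge0 ?(ltW s0)//.
rewrite ler_wpM2r ?invr_ge0 ?(ltW s0)//.
have A := gauss_factor_le n eps.
have A0 := expR_ge0 (- (n%:R * eps ^+ 2) / 16).
have B0 : 0 <= expR (- (eps * n%:R) / 2) * Num.sqrt (1 + eps) ^+ n.
  by rewrite mulr_ge0 ?expR_ge0// exprn_ge0// sqrtr_ge0.
have B1 : expR (- (eps * n%:R) / 2) * Num.sqrt (1 + eps) ^+ n <= 1.
  have -> : - (eps * n%:R) / 2 = n%:R * (- (eps / 2)) :> R by ring.
  rewrite expRM_natl -exprMn exprn_ile1 ?mulr_ge0 ?expR_ge0 ?sqrtr_ge0//.
  rewrite expRN mulrC ler_pdivrMr ?expR_gt0// mul1r.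
  rewrite -(ler_pXn2r (n := 2)) ?nnegrE ?expR_ge0 ?sqrtr_ge0// sqr_sqrtr ?addr_ge0 ?(ltW e0)//.
  by rewrite -expRM_natl mulrCA mulfV// mulr1 expR_ge1Dx.
by rewrite ler_norml; lra.
Qed.

(** With [y = n eps^2 / 8], the inequality [e^(-y) <= 1 / y] makes the second term [O(1 / n)], hence
    [O(1 / sqrt n)]. *)
Lemma cvg_delta2 (eps : R) : 0 < eps < 1 -> (fun d => delta2 d eps) @ \oo --> 0.
Proof.
move=> /andP[e0 e1].
have C0 : 0 <= (1 + eps) * (8 / eps ^+ 2).
  by rewrite mulr_ge0 ?addr_ge0 ?(ltW e0)// divr_ge0// sqr_ge0.
apply: (cvg0_le_invsqrt _ (1 + (1 + eps) * (8 / eps ^+ 2))); first by rewrite addr_ge0.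
move=> n n0; have s0 : 0 < Num.sqrt n%:R :> R by rewrite sqrtr_gt0 ltr0n.
have nr : 0 < n%:R :> R by rewrite ltr0n.
rewrite /delta2 ger0_norm; last first.
  by rewrite addr_ge0// ?mulr_ge0 ?divr_ge0 ?expR_ge0 ?addr_ge0 ?sqrtr_ge0 ?(ltW e0).
rewrite [leRHS]mulrDl lerD//.
  by rewrite ler_wpM2r ?invr_ge0 ?(ltW s0)// gauss_factor_le.
apply: le_trans (le_div_sqrt_nat _ n C0 n0).
rewrite -mulrA ler_wpM2l ?addr_ge0 ?(ltW e0)// mulNr expRN.
have -> : 8 / eps ^+ 2 / n%:R = (n%:R * eps ^+ 2 / 8)^-1 by field; rewrite !gt_eqF.
have p0 : 0 < n%:R * eps ^+ 2 / 8 by rewrite divr_gt0// mulr_gt0// exprn_gt0.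
rewrite lef_pV2 ?posrE ?expR_gt0//.
by apply: le_trans (expR_ge1Dx _); rewrite lerDr.
Qed.

End Limits.

Theorem theorem1 (R : realType) (eps : R) (heps : 0 < eps < 1) :
  (* (1) deterministic two-sided bound *)
  (forall (d : nat) (dG : measure_display) (G : measurableType dG)
     (mu : probability G R) (mulg : G -> G -> G) (invg : G -> G) (oneg : G)
     (rho : G -> 'M[R]_d),
   (2 <= d)%N -> orth_haar_action mu mulg invg oneg rho ->
   forall x z : 'cV[R]_d, on_sphere x -> on_sphere z ->
     eps - delta2 d eps <= Ks mu rho eps x z - (1 - dG_orbit mu rho x z)
     <= eps + delta1 d eps)
  /\
  (* (2) the error terms vanish, hence K_s - (s - d_G) -> 0 uniformly *)
  ((fun d => delta1 d eps) @ \oo --> 0%R) /\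
  ((fun d => delta2 d eps) @ \oo --> 0%R) /\
  (forall eta : R, 0 < eta -> exists D : nat, forall d : nat, (D <= d)%N ->
     forall (dG : measure_display) (G : measurableType dG)
       (mu : probability G R) (mulg : G -> G -> G) (invg : G -> G) (oneg : G)
       (rho : G -> 'M[R]_d),
     orth_haar_action mu mulg invg oneg rho ->
     forall x z : 'cV[R]_d, on_sphere x -> on_sphere z ->
       `| Ks mu rho eps x z - ((1 + eps) - dG_orbit mu rho x z) | <= eta)
  /\
  (* (3) symmetry, positive semi-definiteness, G-invariance *)
  (forall (d : nat) (dG : measure_display) (G : measurableType dG)
     (mu : probability G R) (mulg : G -> G -> G) (invg : G -> G) (oneg : G)
     (rho : G -> 'M[R]_d),
   (2 <= d)%N -> orth_haar_action mu mulg invg oneg rho ->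
   (forall x z : 'cV[R]_d, on_sphere x -> on_sphere z ->
      Ks mu rho eps x z = Ks mu rho eps z x)
   /\ (forall (n : nat) (xs : 'I_n -> 'cV[R]_d) (c : 'I_n -> R),
        (forall i, on_sphere (xs i)) ->
        0 <= \sum_(i < n) \sum_(j < n) c i * c j * Ks mu rho eps (xs i) (xs j))
   /\ (forall (g g' : G) (x z : 'cV[R]_d), on_sphere x -> on_sphere z ->
        Ks mu rho eps (rho g *m x) (rho g' *m z) = Ks mu rho eps x z)).
Proof.
split; [|split; [exact: cvg_delta1|split; [exact: cvg_delta2|split]]].
- move=> d dG G mu mulg invg oneg rho d2 Hact x z x1 z1.
  exact: (Ks_dG_bounds d dG G mu mulg invg oneg rho Hact).
- move=> eta eta0.
  have /cvgrPdist_le/(_ eta eta0)[D1 _ h1] := cvg_delta1 eps heps.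
  have /cvgrPdist_le/(_ eta eta0)[D2 _ h2] := cvg_delta2 eps heps.
  (* The 2 makes the deterministic bounds applicable; [D1] and [D2] make both error terms at most
     [eta]. *)
  exists (maxn 2 (maxn D1 D2)) => d; rewrite !geq_max => /and3P[d2 dD1 dD2].
  move=> dG G mu mulg invg oneg rho Hact x z x1 z1.
  have /andP[lo hi] := Ks_dG_bounds d dG G mu mulg invg oneg rho Hact eps heps x z d2 x1 z1.
  have := h1 d dD1; have := h2 d dD2.
  rewrite /= !sub0r !normrN !ler_norml => /andP[_ H2] /andP[_ H1].
  move: lo hi; move: (Ks _ _ _ _ _) (dG_orbit _ _ _ _) => K D lo hi.
  by apply/andP; split; lra.
- move=> d dG G mu mulg invg oneg rho d2 Hact; split; [|split].
  + by move=> x z _ _; exact: Ks_sym.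
  + move=> n xs c xs1; apply: (Ks_psd d dG G mu mulg invg oneg rho Hact) => //; exact: leq_trans d2.
  + by move=> g g' x z _ _; exact: (Ks_rho d dG G mu mulg invg oneg rho Hact).
Qed.
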